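(* Let $d\ge1$ and $2+\frac4d<p+1<2^{*}$. Then $PW_+\cup\{0\}$ is connected in the $L^q(\mathbb{R}^d)$-topology for all $q\in(2,2^{*})$.
   Context: $2^{*}=\infty$ if $d=1,2$ and $2^{*}=\frac{2d}{d-2}$ if $d\ge3$. For $f\in H^1(\mathbb{R}^d)$ (complex-valued) define $$\mathcal{H}(f)=\|\nabla f\|_{L^2}^2-\frac{2}{p+1}\|f\|_{L^{p+1}}^{p+1},\qquad \mathcal{K}(f)=\|\nabla f\|_{L^2}^2-\frac{d(p-1)}{2(p+1)}\|f\|_{L^{p+1}}^{p+1},$$ $$\mathcal{N}_2(f)=\|f\|_{L^2}^{p+1-\frac d2(p-1)}\|\nabla f\|_{L^2}^{\frac d2(p-1)-2},\qquad N_2=\inf\{\mathcal{N}_2(f): f\in H^1(\mathbb{R}^d)\setminus\{0\},\ \mathcal{K}(f)\le0\},$$ $$\mathcal{B}(f)=\frac{d(p-1)-4}{d(p-1)}\Big(\frac{N_2}{\|f\|_{L^2}^{p+1-\frac d2(p-1)}}\Big)^{\frac{4}{d(p-1)-4}}\quad (f\ne0).$$ $PW=\{f\in H^1(\mathbb{R}^d)\setminus\{0\}:\mathcal{H}(f)<\mathcal{B}(f)\}$ and $PW_+=\{f\in PW:\mathcal{K}(f)>0\}$. *)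

(* Defs.v *)
From HB Require Import structures.
From mathcomp Require Import all_boot all_order all_algebra.
From mathcomp Require Import all_classical all_reals all_analysis.
From mathcomp Require Import complex.

Set Implicit Arguments.
Unset Strict Implicit.
Unset Printing Implicit Defensive.

Import Order.TTheory GRing.Theory Num.Theory.
Import numFieldNormedType.Exports ComplexField.Normc.

Local Open Scope classical_set_scope.
Local Open Scope ring_scope.
Local Open Scope complex_scope.

Definition rV_display : measure_display. Proof. exact: default_measure_display. Qed.

Definition complex_display : measure_display. Proof. exact: default_measure_display. Qed.

Section rV_measurable.
Context (R : realType) (n : nat).

Let coord (i : 'I_n) (x : 'rV[R]_n) : R := x ord0 i.

Let rV_set0 : g_sigma_preimage coord set0.
Proof. exact: sigma_algebra0. Qed.

Let rV_setC A : g_sigma_preimage coord A -> g_sigma_preimage coord (~` A).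
Proof. exact: sigma_algebraC. Qed.

Let rV_bigcup (F : _^nat) : (forall i, g_sigma_preimage coord (F i)) ->
  g_sigma_preimage coord (\bigcup_i (F i)).
Proof. exact: sigma_algebra_bigcup. Qed.

HB.instance Definition _ := @isMeasurable.Build rV_display
  'rV[R]_n (g_sigma_preimage coord) rV_set0 rV_setC rV_bigcup.

End rV_measurable.

Lemma measurable_fun_rVP d (T : measurableType d) (R : realType) (n : nat)
    (f : T -> 'rV[R]_n) :
  (forall i, measurable_fun [set: T] (fun x => f x ord0 i)) ->
  measurable_fun [set: T] f.
Proof.
move=> mf _ A mA; rewrite setTI.
suff: g_sigma_preimage (fun i (x : 'rV[R]_n) => x ord0 i) `<=`
    [set B | measurable (f @^-1` B)] by apply.
apply: smallest_sub.
  split=> /=; first by rewrite preimage_set0.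
  - by move=> B mB; rewrite setTD preimage_setC; exact: measurableC.
  - by move=> F mF; rewrite preimage_bigcup; exact: bigcup_measurable.
case: n f mf A mA => [|n] f mf A mA; first by rewrite big_ord0.
rewrite -bigcup_mkord_ord; apply: bigcup_sub => i _ _ [B mB <-] /=.
rewrite setTI -[X in measurable X]setTI -comp_preimage.
exact: mf.
Qed.

Lemma measurable_coord (R : realType) (n : nat) (i : 'I_n) :
  measurable_fun [set: 'rV[R]_n] (fun x => x ord0 i).
Proof.
move=> _ Y mY; rewrite setTI; apply: sub_sigma_algebra => /=.
rewrite -bigcup_seq/=; exists i => /=; first by rewrite mem_index_enum.
by exists Y => //; rewrite setTI.
Qed.

Section lebesgue_rV.
Context (R : realType).

Definition rV_cons n (x : R * 'rV[R]_n) : 'rV[R]_n.+1 :=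
  \row_i oapp (x.2 ord0) x.1 (unlift ord0 i).

Definition rV_uncons n (x : 'rV[R]_n.+1) : R * 'rV[R]_n :=
  (x ord0 ord0, \row_j x ord0 (lift ord0 j)).

Lemma rV_consK n : cancel (@rV_cons n) (@rV_uncons n).
Proof.
move=> [a x]; congr pair; first by rewrite mxE unlift_none.
by apply/rowP => j; rewrite !mxE liftK.
Qed.

Lemma measurable_rV_cons n : measurable_fun setT (@rV_cons n).
Proof.
apply: measurable_fun_rVP => i; rewrite /rV_cons.
under eq_fun do rewrite mxE.
case: unliftP => [j _|_] /=; last exact: measurable_fst.
exact: (measurableT_comp (measurable_coord j) measurable_snd).
Qed.

Lemma measurable_rV_uncons n : measurable_fun setT (@rV_uncons n).
Proof.
apply/measurable_fun_pairP; split; first exact: measurable_coord.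
apply: measurable_fun_rVP => j.
under eq_fun do rewrite /= mxE.
exact: measurable_coord.
Qed.

Section step.
Context (n : nat) (m : {sigma_finite_measure set 'rV[R]_n -> \bar R}).

Definition lebesgue_rV_step :=
  pushforward (lebesgue_measure \x m)%E (@rV_cons n).

Let measurable_preimage A : measurable A -> measurable (@rV_cons n @^-1` A).
Proof. by move=> mA; rewrite -[X in measurable X]setTI; exact: measurable_rV_cons. Qed.

Let lebesgue_rV_step0 : lebesgue_rV_step set0 = 0%E.
Proof. by rewrite /lebesgue_rV_step /pushforward preimage_set0 measure0. Qed.

Let lebesgue_rV_step_ge0 A : (0 <= lebesgue_rV_step A)%E.
Proof. by rewrite /lebesgue_rV_step /pushforward measure_ge0. Qed.

Let lebesgue_rV_step_sigma_additive : semi_sigma_additive lebesgue_rV_step.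
Proof.
move=> F mF tF mUF; rewrite /lebesgue_rV_step /pushforward preimage_bigcup.
apply: measure_semi_sigma_additive.
- by move=> k; exact: measurable_preimage.
- apply/trivIsetP => /= i j _ _ ij; rewrite -preimage_setI.
  by move/trivIsetP : tF => /(_ _ _ _ _ ij) ->//; rewrite preimage_set0.
- by rewrite -preimage_bigcup; exact: measurable_preimage.
Qed.

Let lebesgue_rV_step_sigma_finite : sigma_finite setT lebesgue_rV_step.
Proof.
have /sigma_finiteP[F [TF ndF Foo]] := sigma_finiteT (@lebesgue_measure R).
have /sigma_finiteP[G [TG ndG Goo]] := sigma_finiteT m.
exists (fun k => @rV_uncons n @^-1` (F k `*` G k)).
  rewrite -preimage_bigcup (_ : \bigcup_k _ = setT) ?preimage_setT//.
  rewrite -setXTT TF TG predeqE => -[x y]; split.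
    by move=> [k _ [/= Fx Gy]]; split; exists k.
  move=> [/= [k _ Fx] [l _ Gy]]; exists (maxn k l) => //; split.
  - by move: x Fx; exact/subsetPset/ndF/leq_maxl.
  - by move: y Gy; exact/subsetPset/ndG/leq_maxr.
move=> k; have [mF Fy] := Foo k; have [mG Gy] := Goo k.
have mFG : measurable (F k `*` G k) by exact: measurableX.
split; first by rewrite -[X in measurable X]setTI; exact: measurable_rV_uncons.
rewrite /lebesgue_rV_step /pushforward -comp_preimage.
rewrite (_ : _ \o _ = id); last by apply/funext => x /=; rewrite rV_consK.
by rewrite /= product_measure1E// lte_mul_pinfty// ge0_fin_numE.
Qed.

HB.instance Definition _ := isMeasure.Build _ _ _ lebesgue_rV_step
  (lebesgue_rV_step0) (lebesgue_rV_step_ge0) (lebesgue_rV_step_sigma_additive).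

HB.instance Definition _ := Measure_isSigmaFinite.Build _ _ _ lebesgue_rV_step
  lebesgue_rV_step_sigma_finite.

End step.

(* Lebesgue measure on [R^n], by recursion on [n] through the identification
   [R^(n+1) = R * R^n]; on the one-point space [R^0] it is the unit mass *)
Fixpoint lebesgue_rV (n : nat) : {sigma_finite_measure set 'rV[R]_n -> \bar R} :=
  match n with
  | 0%N => \d_(0 : 'rV[R]_0)
  | m.+1 => lebesgue_rV_step (lebesgue_rV m)
  end.

End lebesgue_rV.
Arguments lebesgue_rV : simpl never.

Section complex_measurable.
Context (R : realType).

HB.instance Definition _ := isPointed.Build R[i] 0.

Let C_set0 : g_sigma_preimageU (@complex.Re R) (@complex.Im R) set0.
Proof. exact: sigma_algebra0. Qed.

Let C_setC A : g_sigma_preimageU (@complex.Re R) (@complex.Im R) A ->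
  g_sigma_preimageU (@complex.Re R) (@complex.Im R) (~` A).
Proof. exact: sigma_algebraC. Qed.

Let C_bigcup (F : _^nat) :
  (forall i, g_sigma_preimageU (@complex.Re R) (@complex.Im R) (F i)) ->
  g_sigma_preimageU (@complex.Re R) (@complex.Im R) (\bigcup_i (F i)).
Proof. exact: sigma_algebra_bigcup. Qed.

HB.instance Definition _ := @isMeasurable.Build complex_display R[i]
  (g_sigma_preimageU (@complex.Re R) (@complex.Im R)) C_set0 C_setC C_bigcup.

End complex_measurable.

(* classes of functions [R^d -> C] modulo equality almost everywhere; every
   Lebesgue measurable function has a Borel representative, so Borel measurable
   functions suffice *)
Definition cfun (R : realType) (d : nat) : Type :=
  {mfun_ (lebesgue_rV R d), 'rV[R]_d >-> R[i]}.

HB.instance Definition _ (R : realType) (d : nat) := Choice.on (cfun R d).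
HB.instance Definition _ (R : realType) (d : nat) := EqQuotient.on (cfun R d).

Definition cfun_to_fun (R : realType) (d : nat) (f : cfun R d) :
  'rV[R]_d -> R[i] := aqEqMfun_to_fun f.
Coercion cfun_to_fun : cfun >-> Funclass.

Section sobolev.
Context (R : realType) (d : nat).

Local Notation Rd := 'rV[R]_d.
Local Notation leb := (lebesgue_rV R d).
Local Notation cfun := (cfun R d).

Definition cfun0 : cfun := (\pi_cfun (cst 0))%qT.

Definition cLnorm (q : R) (f : Rd -> R[i]) : \bar R :=
  ('N[leb]_(q%:E)[(fun x => (normc (f x))%:E)])%E.

Definition cintegral (f : Rd -> R[i]) : R[i] :=
  (\int[leb]_x complex.Re (f x)) +i* (\int[leb]_x complex.Im (f x)).

Definition partial (i : 'I_d) (phi : Rd -> R) : Rd -> R :=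
  fun x => 'D_(delta_mx ord0 i) phi x.

(* [s] lists the indices along which one differentiates *)
Definition smooth (phi : Rd -> R) : Prop :=
  forall s : seq 'I_d, let psi := foldr partial phi s in
    continuous psi /\ forall i x, derivable psi x (delta_mx ord0 i).

Definition test_function (phi : Rd -> R) : Prop :=
  smooth phi /\ compact (closure [set x | phi x != 0]).

Definition weak_partial (i : 'I_d) (f g : Rd -> R[i]) : Prop :=
  forall phi, test_function phi ->
    cintegral (fun x => f x * (partial i phi x)%:C) =
    - cintegral (fun x => g x * (phi x)%:C).

Definition weak_grad (f : cfun) (g : 'I_d -> cfun) : Prop :=
  forall i, (cLnorm 2 (g i) < +oo)%E /\ weak_partial i f (g i).

Definition H1 : set cfun :=
  [set f : cfun | (cLnorm 2 f < +oo)%E /\ exists g, weak_grad f g].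

(* the weak gradient is unique, so the choice made by [xget] is immaterial on
   [H1]; off [H1] it is a dummy value *)
Definition grad (f : cfun) : 'I_d -> cfun := xget (fun=> cfun0) (weak_grad f).

(* [fine] is harmless for the norms below: they are finite on [H1] (for the
   exponent [p + 1] by the Sobolev embedding) *)
Definition normL (q : R) (f : cfun) : R := fine (cLnorm q f).

Definition normgrad (f : cfun) : R :=
  fine ('N[leb]_(2%:E)[(fun x =>
    (Num.sqrt (\sum_(i < d) normc (grad f i x) ^+ 2)%R)%:E)])%E.

Definition sobolev_exponent : \bar R :=
  if (d <= 2)%N then +oo%E else ((2 * d%:R) / (d%:R - 2))%:E.

Section functionals.
Context (p : R).
Local Notation D := (d%:R : R).

Definition energy (f : cfun) : R :=
  normgrad f ^+ 2 - 2 / (p + 1) * normL (p + 1) f `^ (p + 1).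

Definition virial (f : cfun) : R :=
  normgrad f ^+ 2
  - (D * (p - 1)) / (2 * (p + 1)) * normL (p + 1) f `^ (p + 1).

Definition scaleN2 (f : cfun) : R :=
  normL 2 f `^ (p + 1 - D / 2 * (p - 1))
  * normgrad f `^ (D / 2 * (p - 1) - 2).

Definition infN2 : R :=
  inf [set scaleN2 f | f in [set f | H1 f /\ f <> cfun0 /\ virial f <= 0]].

Definition barrier (f : cfun) : R :=
  (D * (p - 1) - 4) / (D * (p - 1))
  * (infN2 / normL 2 f `^ (p + 1 - D / 2 * (p - 1)))
    `^ (4 / (D * (p - 1) - 4)).

Definition PW : set cfun :=
  [set f | H1 f /\ f <> cfun0 /\ energy f < barrier f].

Definition PWplus : set cfun := [set f | PW f /\ 0 < virial f].

End functionals.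

(* [cfun] with the topology of the extended metric [‖f - g‖_(L^q)]: the classes
   of finite norm, i.e. [L^q], form a clopen subspace, on which this is the
   usual topology of [L^q] *)
Definition cfun_Lq (q : R) : Type := cfun.
HB.instance Definition _ (q : R) := Choice.on (cfun_Lq q).

Definition Lq_open (q : R) : set_system (cfun_Lq q) :=
  [set U | forall f : cfun, U f -> exists2 e : R, 0 < e &
     forall g : cfun, (cLnorm q (fun x => (g x - f x)%R) < e%:E)%E -> U g].

Lemma Lq_openT (q : R) : @Lq_open q setT.
Proof. by move=> f _; exists 1. Qed.

Lemma Lq_openI (q : R) : setI_closed (@Lq_open q).
Proof.
move=> U V oU oV f [/oU[a a0 aU] /oV[b b0 bV]].
exists (Num.min a b); first by rewrite lt_min a0.
move=> g; rewrite EFin_min lt_min => /andP[ga gb].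
by split; [exact: aU|exact: bV].
Qed.

Lemma Lq_open_bigU (q : R) (I : Type) (F : I -> set (cfun_Lq q)) :
  (forall i, Lq_open (F i)) -> Lq_open (\bigcup_i F i).
Proof.
move=> oF f [i _ /oF[e e0 eF]]; exists e => // g /eF Fg.
by exists i.
Qed.

HB.instance Definition _ (q : R) := isOpenTopological.Build (cfun_Lq q)
  (@Lq_openT q) (@Lq_openI q) (@Lq_open_bigU q).

End sobolev.
Arguments cfun0 {R d}.
Arguments PWplus : clear implicits.
Arguments cfun_Lq : clear implicits.

(* Main.v *)
From HB Require Import structures.
Require Import Defs.
From mathcomp Require Import all_boot all_order all_algebra.
From mathcomp Require Import all_classical all_reals all_analysis.
From mathcomp Require Import measurable_realfun complex ring lra.

Set Implicit Arguments.
Unset Strict Implicit.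
Unset Printing Implicit Defensive.

Import Order.TTheory GRing.Theory Num.Theory.
Import numFieldNormedType.Exports ComplexField.Normc.
Local Open Scope classical_set_scope.
Local Open Scope ring_scope.

(** [PWplus] together with [0] is star-shaped about [0]: every ray
    [t |-> t f], [0 <= t <= 1], that ends at a point [f] of [PWplus] stays in
    the set, and in the topology of L^q it is a Lipschitz curve.  Connectedness
    follows, all these rays sharing the point [0].  There are two things to
    prove.

    The ray stays in the set.  Put [s = d(p-1)/4], which exceeds 1 because the
    nonlinearity is mass supercritical, [A = ||grad f||_2^2] and
    [C = 2/(p+1) ||f||_(p+1)^(p+1)], so that [H(f) = A - C] and
    [K(f) = A - s C].  The barrier is homogeneous: [B(t f) = t^(-g) B(f)] with
    [g = (p+1-2s)/(s-1)].  Multiplying [H(t f)] by [t^g] turns it into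
    [x A - x^s C] with [x = t^((p-1)/(s-1))] in ]0, 1], and Bernoulli's
    inequality [1 - x^s <= s (1 - x)] together with [s C < A] gives
    [t^g H(t f) <= H(f) < B(f) = t^g B(t f)]: see [energy_path_le] and
    [PWplus_scale].  That the norm of the chosen weak gradient is homogeneous
    rests on the uniqueness of weak gradients, hence on the fundamental lemma of
    the calculus of variations [fundamental_lemma].

    The ray is Lipschitz for the norm of L^q with constant [||f||_q], which has
    to be finite: this is the Sobolev embedding [H1_Lq] of H^1 into L^q for
    [2 < q < 2*].  Since the exponent is subcritical, it can be obtained by
    estimating distribution functions instead of smoothing [f].  The only
    information on the gradient that is used is the L^2 modulus of continuity
    [||f(. + y) - f||_2 = O(|y|)], which comes from the fundamental theorem of
    calculus along the coordinate axes ([weak_deriv_difference]).  Suppose that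
    [|{|f| > t}| = O(t^(-r))], and let [Q] be the cube of side [e] whose volume
    [e^d] is twice this bound at level [t/2].  If [|f(x)| > t], then
    [|f(x + y)| <= t/2] for at least half of the [y] in [Q], and for these
    [|f(x + y) - f(x)| >= t/2].  Integrating the square of this difference over
    [x] and [y] bounds [|{|f| > t}|] by a multiple of [(e/t)^2], that is of
    [t^(-(2 + 2r/d))] ([weak_type_step]).  Starting from [r = 2], which is
    Chebyshev's inequality, the iteration of [r |-> 2 + 2r/d] passes every
    exponent below [2*] ([bootstrap_exponent_exceeds]), and the decay of the
    distribution function then gives integrability of [|f|^q]. *)

(** * Lebesgue measure on R^n is translation invariant *)

Section lebesgue_rV_theory.
Context {R : realType}.

Lemma lebesgue_measure_translation (c : R) (A : set R) : measurable A ->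
  @lebesgue_measure R ((fun x => x + c) @^-1` A) = lebesgue_measure A.
Proof.
pose tau : measurableTypeR R -> measurableTypeR R := fun x => x + c.
have mc : measurable_fun [set: measurableTypeR R] tau by exact: measurable_funD.
pose mtau : {mfun measurableTypeR R >-> measurableTypeR R} :=
  HB.pack tau (isMeasurableFun.Build _ _ _ _ tau mc).
move=> mA; apply/esym.
apply: (lebesgue_measure_unique (mu := pushforward (@lebesgue_measure R) mtau)) =>
  //= _ [[a b] _ <-] /=.
rewrite /pushforward /= /tau.
rewrite (_ : _ @^-1` _ = `]a - c, b - c]%classic); last first.
  by apply/seteqP; split => x /=; rewrite !in_itv /= ltrBlDr lerBrDr.
rewrite !lebesgue_measure_itv /= !lte_fin ltrD2r; case: ifP => // _.
by rewrite -!EFinB; congr EFin; ring.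
Qed.

Lemma measurable_rV_translation n (v : 'rV[R]_n) :
  measurable_fun [set: 'rV[R]_n] (fun x => x + v).
Proof.
apply: measurable_fun_rVP => i.
under eq_fun do rewrite mxE.
apply: measurable_funD => //; exact: measurable_coord.
Qed.

(** By induction on the dimension: a translation of R^(n+1) is one of the
    sections in R^n followed by one of the line. *)
Lemma lebesgue_rV_translation n (v : 'rV[R]_n) (A : set 'rV[R]_n) :
  measurable A -> lebesgue_rV R n ((fun x => x + v) @^-1` A) = lebesgue_rV R n A.
Proof.
elim: n v A => [v A mA|n IH v A mA].
  congr (_ _); apply/seteqP; split=> x /=; by rewrite (_ : x + v = x)//;
    apply/rowP => -[].
change (lebesgue_rV_step (lebesgue_rV R n) ((fun x => x + v) @^-1` A) =
  lebesgue_rV_step (lebesgue_rV R n) A).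
rewrite /lebesgue_rV_step /pushforward /product_measure1 /=.
set a := v ord0 ord0; set w : 'rV[R]_n := \row_j v ord0 (lift ord0 j).
have mcA : measurable (@rV_cons R n @^-1` A).
  by rewrite -[X in measurable X]setTI; exact: measurable_rV_cons.
pose F (t : measurableTypeR R) := lebesgue_rV R n (xsection (@rV_cons R n @^-1` A) t).
have mF : measurable_fun [set: measurableTypeR R] F.
  exact: measurable_fun_xsection.
transitivity (\int[lebesgue_measure]_(t in [set: measurableTypeR R]) F (t + a)%R)%E.
  apply: eq_integral => t _; rewrite /F /=.
  rewrite -[RHS](IH w); last exact: measurable_xsection.
  congr (_ _); rewrite !xsectionE; apply/seteqP; split => x /=;
  (rewrite (_ : rV_cons (t, x) + v = rV_cons (t + a, x + w))//; apply/rowP => i;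
  rewrite !mxE /=; case: unliftP => [j ->|->] //=; by rewrite !mxE).
pose tau : measurableTypeR R -> measurableTypeR R := fun x => x + a.
have mtau : measurable_fun [set: measurableTypeR R] tau by exact: measurable_funD.
have <- := (@ge0_integral_pushforward _ _ _ _ _ tau mtau (@lebesgue_measure R) setT F
  measurableT mF _); last by move=> y _; exact: measure_ge0.
apply: eq_measure_integral => B mB _.
exact: lebesgue_measure_translation.
Qed.

Definition cube n (e : R) : set 'rV[R]_n := [set x | forall i, 0 <= x ord0 i <= e].

Lemma measurable_rV_forall n (P : 'I_n -> set R) : (forall i, measurable (P i)) ->
  measurable [set x : 'rV[R]_n | forall i, P i (x ord0 i)].
Proof.
move=> mP; rewrite (_ : [set _ | _] =
    \bigcap_(i in [set: 'I_n]) ((fun x : 'rV[R]_n => x ord0 i) @^-1` P i)).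
  apply: fin_bigcap_measurable => // i _.
  by rewrite -[X in measurable X]setTI; exact: measurable_coord.
by apply/seteqP; split=> x /= h i; [move=> _|]; exact: h.
Qed.

Lemma measurable_cube n e : measurable (@cube n e).
Proof.
apply: (@measurable_rV_forall n (fun=> `[0, e]%classic)) => i.
exact: measurable_itv.
Qed.

Lemma lebesgue_cube n e : 0 <= e -> lebesgue_rV R n (cube e) = (e ^+ n)%:E.
Proof.
move=> e0; elim: n => [|n IH].
  have -> : @cube 0 e = setT by apply/seteqP; split=> // x _ [].
  by rewrite /lebesgue_rV /= diracT expr0.
change (lebesgue_rV_step (lebesgue_rV R n) (@cube n.+1 e) = (e ^+ n.+1)%:E).
rewrite /lebesgue_rV_step /pushforward.
rewrite (_ : _ @^-1` _ = `[0, e]%classic `*` @cube n e).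
  rewrite product_measure1E//; last exact: measurable_cube.
  rewrite IH exprS EFinM; congr (_ * _)%E; apply: (etrans (lebesgue_measure_itv _)).
  by rewrite /= lte_fin; case: ltgtP e0 => // [_|<-] _; rewrite ?sube0.
apply/seteqP; split=> [[t x] /= h|[t x] /= [te xe] i].
  split=> /=; first by have := h ord0; rewrite mxE unlift_none in_itv.
  by move=> i; have := h (lift ord0 i); rewrite mxE liftK.
by rewrite mxE; case: unliftP => [j _|_] /=; [exact: xe|move: te; rewrite in_itv].
Qed.

End lebesgue_rV_theory.

Section integral_translation.
Context {R : realType}.
Local Open Scope ereal_scope.

Lemma ge0_integral_translation n (v : 'rV[R]_n) (F : 'rV[R]_n -> \bar R) :
  measurable_fun [set: 'rV[R]_n] F -> (forall x, 0 <= F x) ->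
  \int[lebesgue_rV R n]_x F (x + v)%R = \int[lebesgue_rV R n]_x F x.
Proof.
move=> mF F0.
have mt := measurable_rV_translation v.
have <- := (@ge0_integral_pushforward _ _ _ _ _ _ mt (lebesgue_rV R n) setT F
  measurableT mF _); last by move=> y _; exact: F0.
apply: eq_measure_integral => B mB _; exact: lebesgue_rV_translation.
Qed.

Lemma integral_translation n (v : 'rV[R]_n) (F : 'rV[R]_n -> \bar R) :
  measurable_fun [set: 'rV[R]_n] F ->
  \int[lebesgue_rV R n]_x F (x + v)%R = \int[lebesgue_rV R n]_x F x.
Proof.
move=> mF; rewrite (_ : (fun x => _) = F \o (+%R^~ v))//.
rewrite integralE [RHS]integralE funepos_comp funeneg_comp; congr (_ - _).
- exact: (ge0_integral_translation v (measurable_funepos mF) (funepos_ge0 F)).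
- exact: (ge0_integral_translation v (measurable_funeneg mF) (funeneg_ge0 F)).
Qed.

Lemma Rintegral_translation n (v : 'rV[R]_n) (F : 'rV[R]_n -> R) :
  measurable_fun [set: 'rV[R]_n] F ->
  (\int[lebesgue_rV R n]_x F (x + v) = \int[lebesgue_rV R n]_x F x)%R.
Proof.
by move=> mF; congr fine; apply: (integral_translation v (F := EFin \o F));
  exact/measurable_EFinP.
Qed.

Lemma integrable_translation n (v : 'rV[R]_n) (F : 'rV[R]_n -> \bar R) :
  (lebesgue_rV R n).-integrable setT F ->
  (lebesgue_rV R n).-integrable setT (fun x => F (x + v)%R).
Proof.
move=> /integrableP[mF Foo]; apply/integrableP; split.
  exact: (measurableT_comp mF (measurable_rV_translation v)).
have mabs : measurable_fun setT (abse \o F) by exact: measurableT_comp.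
by rewrite (ge0_integral_translation v mabs) // => x; exact: abse_ge0.
Qed.
End integral_translation.

(** * Smooth functions and bumps on the line *)

Section smooth_line.
Context {R : realType}.
Implicit Types (f g : R -> R).

(** Derivatives are given by a witness, so that closure under sums, products and
    affine substitutions is a plain induction on the order. *)
Fixpoint Cdiff (n : nat) (f : R -> R) : Prop :=
  if n is m.+1 then exists2 g, Cdiff m g & forall x : R, is_derive x 1 f (g x)
  else continuous f.

Lemma is_derive_continuous f g : (forall x : R, is_derive x 1 f (g x)) -> continuous f.
Proof.
by move=> df x; apply/differentiable_continuous/derivable1_diffP; have [] := df x.
Qed.

Lemma CdiffW n f : Cdiff n.+1 f -> Cdiff n f.
Proof.
elim: n f => [|n IH] f [g Cg df]; first exact: is_derive_continuous df.
by exists g => //; exact: IH.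
Qed.

Lemma CdiffD n f g : Cdiff n f -> Cdiff n g -> Cdiff n (f + g).
Proof.
elim: n f g => [|n IH] f g.
  by move=> cf cg x; apply: continuousD; [exact: cf|exact: cg].
move=> [f' Cf df] [g' Cg dg]; exists (f' + g'); first exact: IH.
by move=> x; apply: is_deriveD.
Qed.

Lemma CdiffM n f g : Cdiff n f -> Cdiff n g -> Cdiff n (f * g).
Proof.
elim: n f g => [|n IH] f g.
  by move=> cf cg x; apply: continuousM; [exact: cf|exact: cg].
move=> Cf Cg; have Cfn := CdiffW Cf; have Cgn := CdiffW Cg.
case: Cf Cg => f' Cf df [g' Cg dg]; exists (f * g' + g * f').
  by apply: CdiffD; exact: IH.
by move=> x; apply: is_deriveM.
Qed.

Lemma Cdiff_cst n c : Cdiff n (cst c).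
Proof.
elim: n c => [|n IH] c; first exact: cst_continuous.
by exists (cst 0) => // x; exact: is_derive_cst.
Qed.

Lemma CdiffZ n c f : Cdiff n f -> Cdiff n (c \*: f).
Proof. by move=> Cf; apply: (CdiffM (Cdiff_cst n c) Cf). Qed.

Lemma is_derive_affine (c e x : R) : is_derive x 1 (fun t => c * t + e) c.
Proof.
apply: is_derive_eq (is_deriveD (is_deriveZ c (is_derive_id x (1 : R)))
  (is_derive_cst e x (1 : R))) _.
by rewrite addr0 /GRing.scale /= mulr1.
Qed.

Lemma Cdiff_affine n f c e : Cdiff n f -> Cdiff n (fun x => f (c * x + e)).
Proof.
elim: n f => [|n IH] f.
  move=> cf x; apply: (@continuous_comp _ _ _ (fun x => c * x + e) f); last exact: cf.
  by apply/differentiable_continuous/derivable1_diffP;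
    have [] := is_derive_affine c e x.
move=> [f' Cf df]; exists (c \*: (fun x => f' (c * x + e))); first exact/CdiffZ/IH.
move=> x.
have := @is_derive1_comp R f (fun t => c * t + e) x _ _ (df _) (is_derive_affine c e x).
by move/is_derive_eq; apply; rewrite mulrC.
Qed.

Definition smooth1 f := forall n, Cdiff n f.

(** The witnesses for the various orders are derivatives of one function, hence
    equal. *)
Lemma smooth1_derive f : smooth1 f ->
  exists2 g, smooth1 g & forall x : R, is_derive x 1 f (g x).
Proof.
move=> sf; have [g0 _ df] := sf 1%N; exists g0 => // n.
have [g Cg dg] := sf n.+1; suff -> : g0 = g by [].
apply/funext => x.
by rewrite -(@derive_val _ _ _ _ _ _ _ (df x)) -(@derive_val _ _ _ _ _ _ _ (dg x)).
Qed.

Lemma smooth1_antiderivative f g : smooth1 g ->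
  (forall x : R, is_derive x 1 f (g x)) -> smooth1 f.
Proof.
by move=> sg df [|n]; [exact: is_derive_continuous df|exists g => //; exact: sg].
Qed.

(** The functions [t^(-k) exp(-1/t)], extended by 0: up to linear combinations the
    family is closed under differentiation, hence all its members are smooth. *)
Definition flat k (t : R) : R := if 0 < t then t^-1 ^+ k * expR (- t^-1) else 0.

(** From [exp (1/t) >= t^(-(k+2)) / (k+2)!].  A quadratic bound at the origin is what
    makes the derivative vanish there. *)
Lemma flat_bound k (t : R) : 0 < t -> `|flat k t| <= (k.+2)`!%:R * t ^+ 2.
Proof.
move=> t0; rewrite /flat t0 ger0_norm;
  last by rewrite mulr_ge0 ?expR_ge0// exprn_ge0// invr_ge0 ltW.
rewrite expRN ler_pdivrMr ?expR_gt0//.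
have h : t^-1 ^+ k.+2 / (k.+2)`!%:R <= expR t^-1.
  apply: le_trans (@expR_ge1Dxn R t^-1 k.+1 _); last by rewrite invr_ge0 ltW.
  by rewrite lerDr.
rewrite ler_pdivrMr ?ltr0n ?fact_gt0// in h.
have -> : t^-1 ^+ k = t ^+ 2 * t^-1 ^+ k.+2.
  by rewrite -(addn2 k) exprD mulrCA -exprMn divff ?gt_eqF// expr1n mulr1.
rewrite [leRHS](_ : _ = t ^+ 2 * (expR t^-1 * (k.+2)`!%:R)); last by ring.
by rewrite ler_pM2l ?exprn_gt0.
Qed.

Lemma is_derive_flat k (t : R) :
  is_derive t 1 (flat k) (- k%:R * flat k.+1 t + flat k.+2 t).
Proof.
have [t0|t0|->] := ltgtP t 0.
- have -> : - k%:R * flat k.+1 t + flat k.+2 t = 0.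
    by rewrite /flat !ltNge (ltW t0) /= mulr0 addr0.
  apply: (@near_eq_is_derive _ _ _ (cst 0)).
  near=> x; rewrite /flat ifF//; apply/negbTE; rewrite -leNgt ltW//; near: x.
  exact: lt_nbhsl.
- have t1 : t != 0 by rewrite gt_eqF.
  have dV : is_derive t 1 (fun y : R => y^-1) (- t ^- 2).
    by apply: is_derive_eq (is_deriveV t1 (is_derive_id t 1)) _;
      rewrite /GRing.scale /= mulr1.
  have dX := is_deriveX k dV.
  have dE := is_derive1_comp (is_derive_expR _) (is_deriveN dV).
  have dM := is_deriveM dX dE.
  apply: (@near_eq_is_derive _ _ _
    ((fun y : R => y^-1) ^+ k * (expR \o (- (fun y : R => y^-1))))).
    near=> x; rewrite /flat ifT; last by near: x; exact: lt_nbhsr.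
    by rewrite !fctE.
  apply: is_derive_eq dM _; rewrite /flat t0.
  rewrite !fctE /GRing.scale /=; move: (expR _) => E.
  by case: (k) => [|m] /=; rewrite ?mulr0n ?exprS ?expr0; field.
- have -> : - k%:R * flat k.+1 0 + flat k.+2 0 = 0 :> R.
    by rewrite /flat ltxx mulr0 addr0.
  have C := @flat_bound k.
  have cv : h^-1 *: ((flat k \o shift 0) (h *: (1 : R)) - flat k 0)
      @[h --> (0 : R)^'] --> (0 : R).
    apply/cvgrPdist_le => e e0.
    near=> h.
    rewrite /= sub0r normrN /GRing.scale /= mulr1 addr0 {2}/flat ltxx subr0 normrM.
    have [h0|h0] := ltP 0 h; last by rewrite /flat ltNge h0 /= normr0 mulr0 ltW.
    apply: le_trans (ler_wpM2l (normr_ge0 _) (C h h0)) _.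
    rewrite normrV ?unitfE ?gt_eqF// gtr0_norm//.
    rewrite [leLHS](_ : _ = (k.+2)`!%:R * h); last by field; rewrite gt_eqF.
    rewrite -ler_pdivlMl ?ltr0n ?fact_gt0//; apply: le_trans (ler_norm h) _.
    near: h; apply: dnbhs0_le; rewrite mulr_gt0 ?invr_gt0 ?ltr0n ?fact_gt0//.
  by apply: DeriveDef; [apply/cvg_ex; exists 0|exact: cvg_lim].
Unshelve. all: by end_near.
Qed.

Lemma smooth1_flat k : smooth1 (flat k).
Proof.
move=> n; elim: n k => [|n IH] k; first exact: is_derive_continuous (is_derive_flat k).
exists ((- k%:R) \*: flat k.+1 + flat k.+2); first by apply: CdiffD => //;
  exact: CdiffZ.
exact: is_derive_flat.
Qed.
End smooth_line.

Section bumps.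
Context {R : realType}.

(** On ]a, b[ this is [exp (- (1/(t-a) + 1/(b-t)) / (n+1))], so that the sequence
    increases to the indicator of ]a, b[. *)
Definition bump (a b : R) (n : nat) (t : R) : R :=
  flat 0 (n.+1%:R * (t - a)) * flat 0 (n.+1%:R * (b - t)).

Lemma smooth1_bump a b n : smooth1 (bump a b n).
Proof.
move=> m; apply: (@CdiffM _ _ (fun t => flat 0 (n.+1%:R * (t - a)))
  (fun t => flat 0 (n.+1%:R * (b - t)))).
- rewrite (_ : (fun t => _) = fun t => flat 0 (n.+1%:R * t + n.+1%:R * - a)).
    by apply: Cdiff_affine; exact: smooth1_flat.
  by apply/funext => t; rewrite mulrDr.
- rewrite (_ : (fun t => _) = fun t => flat 0 (- n.+1%:R * t + n.+1%:R * b)).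
    by apply: Cdiff_affine; exact: smooth1_flat.
  by apply/funext => t; rewrite mulrBr addrC mulNr.
Qed.

Lemma flat_le0 k (t : R) : t <= 0 -> flat k t = 0.
Proof. by rewrite /flat ltNge => ->. Qed.

Lemma flat0_itv (t : R) : 0 <= flat 0 t <= 1.
Proof.
rewrite /flat; case: ifPn => [t0|]; last by rewrite lexx ler01.
by rewrite expr0 mul1r expR_ge0 expR_le1 oppr_le0 invr_ge0 ltW.
Qed.

Lemma bump_itv a b n t : 0 <= bump a b n t <= 1.
Proof.
have /andP[h0 h1] := flat0_itv (n.+1%:R * (t - a)).
have /andP[k0 k1] := flat0_itv (n.+1%:R * (b - t)).
by rewrite /bump mulr_ge0//= mulr_ile1.
Qed.

Lemma bump_out a b n t : ~~ (a < t < b) -> bump a b n t = 0.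
Proof.
rewrite negb_and -!leNgt => /orP[] h; rewrite /bump.
- by rewrite (@flat_le0 _ (_ * (t - a))) ?mul0r// pmulr_rle0 ?ltr0n// subr_le0.
- by rewrite (@flat_le0 _ (_ * (b - t))) ?mulr0// pmulr_rle0 ?ltr0n// subr_le0.
Qed.

Lemma cvg_flat0 (c : R) : 0 < c -> flat 0 (n.+1%:R * c) @[n --> \oo] --> (1 : R).
Proof.
move=> c0.
rewrite (_ : (fun n => _) = (fun n => expR (- (n.+1%:R^-1 * c^-1)))); last first.
  by apply/funext => n; rewrite /flat pmulr_rgt0 ?ltr0n// c0 expr0 mul1r invfM.
have h : - (n.+1%:R^-1 * c^-1) @[n --> \oo] --> (0 : R).
  rewrite -[X in _ --> X](@oppr0 R); apply: cvgN.
  rewrite -(mul0r c^-1); apply: cvgM; last exact: cvg_cst.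
  exact: cvg_harmonic.
rewrite -[X in _ --> X](@expR0 R).
exact: (continuous_cvg _ (@continuous_expR R 0) h).
Qed.

Lemma cvg_bump a b t : bump a b n t @[n --> \oo] --> (\1_`]a, b[%classic t : R).
Proof.
rewrite indicE; case: (boolP (a < t < b)) => abt.
  rewrite mem_set /= ?in_itv//= -[X in _ --> X]mulr1.
  by case/andP: abt => a1 b1; apply: cvgM; apply: cvg_flat0; rewrite subr_gt0.
rewrite memNset /= ?in_itv//=; last exact/negP.
under eq_fun do rewrite bump_out//.
exact: cvg_cst.
Qed.

End bumps.

(** * Tensor products as test functions *)

Section tensor.
Context {R : realType} {d : nat}.
Implicit Types (phi : 'I_d -> R -> R) (a b : 'I_d -> R).

Definition tensor phi : 'rV[R]_d -> R := fun x => \prod_i phi i (x ord0 i).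

Definition subst_at (i : 'I_d) (f : R -> R) phi : 'I_d -> R -> R :=
  fun j => if j == i then f else phi j.

Lemma tensorE phi i x :
  tensor phi x = phi i (x ord0 i) * \prod_(j | j != i) phi j (x ord0 j).
Proof. by rewrite /tensor (bigD1 i). Qed.

Lemma tensor_subst_at phi i f x :
  tensor (subst_at i f phi) x = f (x ord0 i) * \prod_(j | j != i) phi j (x ord0 j).
Proof.
rewrite (tensorE _ i) /subst_at eqxx; congr (_ * _).
by apply: eq_bigr => j /negbTE ->.
Qed.

Lemma coord_shift i j (h : R) (x : 'rV[R]_d) :
  (h *: delta_mx ord0 i + x) ord0 j = if j == i then h + x ord0 j else x ord0 j.
Proof. by rewrite !mxE eqxx /=; case: eqP => _; rewrite ?mulr1 ?mulr0 ?add0r. Qed.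

(** Along [e_i] only the factor of index [i] varies, and the difference quotient
    is that of this factor times a constant. *)
Lemma is_derive_tensor phi i (f : R -> R) x :
  (forall t : R, is_derive t 1 (phi i) (f t)) ->
  is_derive x (delta_mx ord0 i) (tensor phi) (tensor (subst_at i f phi) x).
Proof.
move=> df.
have [dphi vphi] := df (x ord0 i).
set c := \prod_(j | j != i) phi j (x ord0 j).
have E h : h^-1 *: ((tensor phi \o shift x) (h *: delta_mx ord0 i) - tensor phi x) =
   c *: (h^-1 *: ((phi i \o shift (x ord0 i)) (h *: (1 : R)) - phi i (x ord0 i))).
  rewrite /= !(tensorE phi i) coord_shift eqxx.
  rewrite (eq_bigr (fun j => phi j (x ord0 j))); last first.
    by move=> j /negbTE ji; rewrite coord_shift ji.
  rewrite -/c /GRing.scale /= mulr1; ring.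
have cv : h^-1 *: ((tensor phi \o shift x) (h *: delta_mx ord0 i) - tensor phi x)
    @[h --> 0^'] --> tensor (subst_at i f phi) x.
  under eq_fun do rewrite E.
  rewrite tensor_subst_at mulrC; apply: cvgM; first exact: cvg_cst.
  rewrite -vphi; exact: dphi.
by apply: DeriveDef; [apply/cvg_ex;
  exists (tensor (subst_at i f phi) x)|exact: cvg_lim].
Qed.

Lemma continuous_tensor phi : (forall i, continuous (phi i)) -> continuous (tensor phi).
Proof.
move=> cphi x; rewrite /tensor /continuous_at.
apply: cvg_big => [x0||i _]. exact: mul_continuous. exact: (nbhs_filter x).
apply: (@continuous_comp _ _ _ (fun x : 'rV[R]_d => x ord0 i) (phi i));
  last exact: cphi.
exact: coord_continuous.
Qed.

(** Iterated partial derivatives of a tensor product of smooth functions are again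
    such tensor products. *)
Lemma smooth_tensor phi : (forall i, smooth1 (phi i)) -> smooth (tensor phi).
Proof.
move=> sphi s.
have [phi' sphi' ->] : exists2 phi', (forall i, smooth1 (phi' i)) &
    foldr (@partial R d) (tensor phi) s = tensor phi'.
  elim: s => [|i s [phi' sphi' IH]]; first by exists phi.
  have [f sf df] := smooth1_derive (sphi' i).
  exists (subst_at i f phi'); first by move=> j; rewrite /subst_at; case: eqP.
  rewrite /= IH; apply/funext => x; rewrite /partial.
  exact: (@derive_val _ _ _ _ _ _ _ (is_derive_tensor x df)).
split; first by apply: continuous_tensor => i; exact: (sphi' i 0%N).
move=> i x; have [f _ df] := smooth1_derive (sphi' i).
by have [] := is_derive_tensor x df.
Qed.

Definition cbox a b : set 'rV[R]_d := [set x | forall i, a i <= x ord0 i <= b i].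

Definition supported (f : R -> R) (a b : R) := forall t, ~~ (a <= t <= b) -> f t = 0.

Lemma tensor_out phi a b x : (forall i, supported (phi i) (a i) (b i)) ->
  ~ cbox a b x -> tensor phi x = 0.
Proof.
move=> sphi /existsNP[i /negP nx].
by rewrite (tensorE _ i) sphi ?mul0r.
Qed.

Lemma test_function_tensor phi a b : (forall i, smooth1 (phi i)) ->
  (forall i, supported (phi i) (a i) (b i)) -> test_function (tensor phi).
Proof.
move=> smphi sphi; split; first exact: smooth_tensor.
have cK : compact (cbox a b).
  rewrite (_ : cbox a b = [set v | forall i, `[a i, b i]%classic (v ord0 i)]);
    last first.
    by apply/seteqP; split => x /= h i; have := h i; rewrite in_itv.
  by apply: (rV_compact (A := fun i => `[a i, b i]%classic)) => i;
    exact: segment_compact.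
apply: (subclosed_compact _ cK); first exact: closed_closure.
have clK : closed (cbox a b) by apply: (compact_closed _ cK); exact: norm_hausdorff.
rewrite (closure_id (cbox a b)).1//; apply: closure_subset => x /= tx.
by apply: contrapT => /(tensor_out sphi) t0; rewrite t0 eqxx in tx.
Qed.

End tensor.

(** * The fundamental lemma of the calculus of variations *)

Section boxes.
Context {R : realType} {d : nat}.
Local Notation leb := (lebesgue_rV R d).
Implicit Types (a b : 'I_d -> R) (u : 'rV[R]_d -> R).

Definition obox a b : set 'rV[R]_d := [set x | forall i, a i < x ord0 i < b i].

Lemma measurable_cbox a b : measurable (cbox a b).
Proof. by apply: (measurable_rV_forall (P := fun i => `[a i, b i]%classic)) => i;
  exact: measurable_itv. Qed.

Lemma measurable_obox a b : measurable (obox a b).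
Proof. by apply: (measurable_rV_forall (P := fun i => `]a i, b i[%classic)) => i;
  exact: measurable_itv. Qed.

Lemma obox_cbox a b : obox a b `<=` cbox a b.
Proof. by move=> x h i; have /andP[/ltW -> /ltW ->] := h i. Qed.

Lemma lebesgue_cbox_lty a b : (leb (cbox a b) < +oo)%E.
Proof.
pose e := \sum_i `|b i - a i|; pose v : 'rV[R]_d := \row_i - a i.
have e0 : 0 <= e by apply: sumr_ge0 => i _.
have mcube := @measurable_cube R d e.
apply: (@le_lt_trans _ _ (leb ((fun x => x + v) @^-1` cube e))).
  apply: le_measure; rewrite ?inE.
  - exact: measurable_cbox.
  - by rewrite -[X in measurable X]setTI; exact: measurable_rV_translation.
  move=> x /= xab i; rewrite !mxE subr_ge0; have /andP[-> xb] /= := xab i.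
  apply: (@le_trans _ _ `|b i - a i|).
    by rewrite (le_trans _ (ler_norm _))// lerD2r.
  by rewrite /e (bigD1 i)//= lerDl sumr_ge0.
by rewrite lebesgue_rV_translation// lebesgue_cube// ltry.
Qed.

Definition sqint u := measurable_fun setT u /\ (\int[leb]_x ((u x) ^+ 2)%:E < +oo)%E.

Lemma sqint_integrable u K : sqint u -> measurable K -> (leb K < +oo)%E ->
  leb.-integrable K (EFin \o u).
Proof.
move=> [mu u2] mK Koo; apply/integrableP; split.
  exact/measurable_funTS/measurable_EFinP.
apply: (@le_lt_trans _ _ (\int[leb]_(x in K) (1 + ((u x) ^+ 2)%:E))%E).
  apply: ge0_le_integral => //.
  - apply: measurableT_comp => //; exact/measurable_funTS/measurable_EFinP.
  - apply: emeasurable_funD => //; apply/measurable_funTS/measurable_EFinP.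
    exact: measurable_funX.
  move=> x _ /=; rewrite lee_fin.
  have : 0 <= (`|u x| - 1) ^+ 2 by exact: sqr_ge0.
  have : 0 <= `|u x| by []. rewrite -[u x ^+ 2]real_normK ?num_real//. nra.
rewrite ge0_integralD//; last 2 first.
- by move=> x _; rewrite lee_fin sqr_ge0.
- by apply/measurable_funTS/measurable_EFinP; exact: measurable_funX.
rewrite integral_cst// mul1e lte_add_pinfty//.
apply: le_lt_trans u2; apply: ge0_subset_integral => //.
- by apply/measurable_EFinP; exact: measurable_funX.
- by move=> x _; rewrite lee_fin sqr_ge0.
Qed.

Lemma sqint_integrable_mul u (f : 'rV[R]_d -> R) a b (M : R) :
  sqint u -> measurable_fun setT f -> (forall x, `|f x| <= M) ->
  (forall x, ~ cbox a b x -> f x = 0) ->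
  leb.-integrable setT (EFin \o (u \* f)).
Proof.
move=> su mf fM f0.
have mu := su.1.
have -> : EFin \o (u \* f) = (EFin \o (u \* f)) \_ (cbox a b).
  apply/funext => x; rewrite patchE; case: ifPn => //.
  by move/negP; rewrite inE => /f0 /= ->; rewrite mulr0.
apply/(integrable_mkcond _ (measurable_cbox a b)).
have := sqint_integrable su (measurable_cbox a b) (lebesgue_cbox_lty a b).
have mM : measurable_fun (cbox a b) f by exact: measurable_funTS.
move=> /(integrableMl (measurable_cbox a b)) => /(_ _ mM).
rewrite (_ : (EFin \o (u \* f)) = ((EFin \o u) \* (EFin \o f))%E)//; apply.
exists M; split; first exact: num_real.
by move=> y My x _ /=; apply: le_trans (fM x) (ltW My).
Qed.

Lemma measurable_tensor (phi : 'I_d -> R -> R) : (forall i, continuous (phi i)) ->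
  measurable_fun setT (tensor phi).
Proof.
move=> cphi; apply: measurable_prod => i _.
by apply: measurableT_comp; [exact: continuous_measurable_fun|exact: measurable_coord].
Qed.

End boxes.

Section box_generators.
Context {R : realType}.

(** Traces on [K], rather than boxes, so that the half-spaces [x_i > c], which
    generate the sigma-algebra, belong to the class when [K] is a box. *)
Definition locally_obox n (K : set 'rV[R]_n) : set (set 'rV[R]_n) :=
  [set A | measurable A /\ exists a b : 'I_n -> R, A `&` K = obox a b].

Lemma obox_setI n (a b a' b' : 'I_n -> R) : obox a b `&` obox a' b' =
  obox (fun i => Num.max (a i) (a' i)) (fun i => Num.min (b i) (b' i)).
Proof.
apply/seteqP; split => x /=.
  by move=> [h h'] i; rewrite gt_max lt_min; have /andP[-> ->] := h i; exact: h'.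
move=> h; split=> i; have := h i; rewrite gt_max lt_min;
  by move=> /andP[/andP[h1 h2] /andP[h3 h4]]; rewrite ?h1 ?h2 ?h3 ?h4.
Qed.

Lemma setI_closed_locally_obox n (K : set 'rV[R]_n) : setI_closed (locally_obox K).
Proof.
move=> A B [mA [a [b AK]]] [mB [a' [b' BK]]]; split; first exact: measurableI.
exists (fun i => Num.max (a i) (a' i)), (fun i => Num.min (b i) (b' i)).
by rewrite -obox_setI -AK -BK setIACA setIid.
Qed.

Lemma measurable_sub_locally_obox n (a b : 'I_n -> R) :
  measurable `<=` <<s locally_obox (obox a b) >>.
Proof.
apply: smallest_sub; first exact: smallest_sigma_algebra.
case: n a b => [|n] a b; first by rewrite big_ord0.
rewrite -bigcup_mkord_ord; apply: bigcup_sub => i _ _ [B mB <-] /=.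
rewrite setTI.
set j : 'I_n.+1 := inord i.
pose S := [set B : set R |
  <<s locally_obox (obox a b) >> ((fun x : 'rV[R]_n.+1 => x ord0 j) @^-1` B)].
have sS : sigma_algebra setT S.
  have [s0 sC sU] := smallest_sigma_algebra setT (locally_obox (obox a b)).
  split.
  - by rewrite /S /= preimage_set0.
  - by move=> A SA; rewrite /S /= setTD preimage_setC -setTD; exact: sC.
  - by move=> F SF; rewrite /S /= preimage_bigcup; exact: sU.
suff : @measurable _ (measurableTypeR R) `<=` S by apply.
rewrite RGenOInfty.measurableE; apply: smallest_sub => // _ [c ->].
apply: sub_gen_smallest; split.
  by rewrite -[X in measurable X]setTI; exact: measurable_coord.
exists (fun k => if k == j then Num.max c (a k) else a k), b.
apply/seteqP; split => x /=.
  rewrite in_itv /= andbT => -[cx h] k; case: eqP => [->|_]; last exact: h.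
  by rewrite gt_max cx; exact: h.
move=> h; split.
  by have := h j; rewrite eqxx gt_max in_itv /= => /andP[/andP[-> _] _].
by move=> k; have := h k; case: eqP => // ->; rewrite gt_max => /andP[/andP[_ ->] ->].
Qed.

End box_generators.

Section fundamental_lemma.
Context {R : realType} {d : nat}.
Local Notation leb := (lebesgue_rV R d).
Implicit Types (a b : 'I_d -> R) (u : 'rV[R]_d -> R).

Lemma tensor_bump_itv a b n (x : 'rV[R]_d) :
  0 <= tensor (fun i => bump (a i) (b i) n) x <= 1.
Proof.
rewrite /tensor; apply/andP; split.
  by apply: prodr_ge0 => i _; have /andP[] := bump_itv (a i) (b i) n (x ord0 i).
by apply: prodr_ile1 => i _; exact: bump_itv.
Qed.

Lemma cvg_tensor_bump a b (x : 'rV[R]_d) :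
  tensor (fun i => bump (a i) (b i) n) x @[n --> \oo] --> (\1_(obox a b) x : R).
Proof.
have -> : \1_(obox a b) x = \prod_i (\1_`]a i, b i[%classic (x ord0 i)) :> R.
  rewrite indicE; have [|/negP] := boolP (x \in obox a b).
    rewrite inE => xab; rewrite big1// => i _.
    by rewrite indicE mem_set//= in_itv; exact: xab.
  rewrite inE => /existsNP[i /negP nx].
  by rewrite (bigD1 i)//= indicE memNset ?mul0r//= in_itv; exact/negP.
rewrite /tensor; apply: cvg_big => [|i _]; first exact: mul_continuous.
exact: cvg_bump.
Qed.

Lemma supported_bump (a b : R) n : supported (bump a b n) a b.
Proof.
move=> t tab; apply: bump_out; apply: contra tab => /andP[/ltW -> /ltW ->] //.
Qed.

Definition test_tensor (phi : 'I_d -> R -> R) a b :=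
  (forall i, smooth1 (phi i)) /\ (forall i, supported (phi i) (a i) (b i)).

Section vanishing.
Variable u : 'rV[R]_d -> R.
Hypothesis su : sqint u.
Hypothesis u0 : forall phi a b, test_tensor phi a b ->
  \int[leb]_x (u x * tensor phi x) = 0.

Let mu : measurable_fun setT u. Proof. exact: su.1. Qed.

(** Dominated convergence along bumps that tend to the indicator of the box. *)
Lemma integral_obox a b : (\int[leb]_(x in obox a b) (u x)%:E = 0)%E.
Proof.
pose phi n i := bump (a i) (b i) n.
have sphi n i : smooth1 (phi n i) by exact: smooth1_bump.
have pphi n i : supported (phi n i) (a i) (b i) by exact: supported_bump.
have mphi n : measurable_fun setT (tensor (phi n)).
  by apply: measurable_tensor => i; exact: (sphi n i 0%N).
have mC := measurable_cbox a b; have mO := measurable_obox a b.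
have iu := sqint_integrable su mC (lebesgue_cbox_lty a b).
have lim0 : (\int[leb]_(x in cbox a b) (u x * tensor (phi n) x)%:E @[n --> \oo] -->
   \int[leb]_(x in cbox a b) (u x * \1_(obox a b) x)%:E)%E.
  apply: (@dominated_cvg _ _ _ leb (cbox a b) mC
     (fun n x => (u x * tensor (phi n) x)%:E) 
     (fun x => (u x * \1_(obox a b) x)%:E) (fun x => `|u x|%:E)) => //.
  - move=> n; apply/measurable_funTS/measurable_EFinP; exact: measurable_funM.
  - move=> x _; apply/cvg_EFin; first exact: nearW.
    by apply: cvgM; [exact: cvg_cst|exact: cvg_tensor_bump].
  - exact: integrable_norm iu.
  - move=> n x _ /=; rewrite lee_fin normrM ler_piMr//.
    by have /andP[h0 h1] := tensor_bump_itv a b n x; rewrite ger0_norm.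
have E n : (\int[leb]_(x in cbox a b) (u x * tensor (phi n) x)%:E = 0)%E.
  have h := u0 (conj (sphi n) (pphi n)).
  have ii : leb.-integrable setT (EFin \o (u \* tensor (phi n))).
    apply: (sqint_integrable_mul (a := a) (b := b) (M := 1) su) => //.
    - by move=> x; have /andP[h0 h1] := tensor_bump_itv a b n x; rewrite ger0_norm.
    - by move=> x; exact: tensor_out.
  rewrite integral_mkcond.
  rewrite (_ : _ \_ _ = EFin \o (u \* tensor (phi n))); last first.
    apply/funext => x; rewrite patchE; case: ifPn => //.
    by move/negP; rewrite inE => /(tensor_out (pphi n)) /= ->; rewrite mulr0.
  rewrite -[LHS]fineK; last exact: integrable_fin_num.
  by congr EFin; exact: h.
move: lim0; under eq_fun do rewrite E.
move=> /cvg_lim; rewrite lim_cst// => /(_ (@ereal_hausdorff R)) L.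
rewrite L (integral_mkcond (cbox a b)) (integral_mkcond (obox a b));
  apply: eq_integral => x _.
rewrite !patchE indicE; case: ifPn => [xO|_]; last by rewrite mulr0; case: ifP.
by rewrite mulr1 ifT//; move: xO; rewrite !inE; exact: obox_cbox.
Qed.

(** Dynkin's pi-lambda theorem, started from the boxes. *)
Lemma integral_measurable_obox a b A : measurable A ->
  (\int[leb]_(x in A `&` obox a b) (u x)%:E = 0)%E.
Proof.
have mK := measurable_obox a b.
have iK : leb.-integrable (obox a b) (EFin \o u).
  apply: (integrableS (measurable_cbox a b)) => //; first exact: obox_cbox.
  exact: sqint_integrable su (measurable_cbox a b) (lebesgue_cbox_lty a b).
pose H := [set A | measurable A /\ (\int[leb]_(x in A `&` obox a b) (u x)%:E = 0)%E].
have iA B : measurable B -> leb.-integrable (B `&` obox a b) (EFin \o u).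
  by move=> mB; apply: integrableS iK => //; exact: measurableI.
have dH : dynkin H.
  split.
  - by split; [exact: measurableT|rewrite setTI; exact: integral_obox].
  - move=> B [mB B0]; split; first exact: measurableC.
    have E : obox a b = (B `&` obox a b) `|` (~` B `&` obox a b).
      by rewrite -setIUl setUv setTI.
    have := integral_obox a b; rewrite {1}E integral_setU.
    + by rewrite B0 add0e.
    + exact: measurableI.
    + by apply: measurableI => //; exact: measurableC.
    + exact/measurable_funTS/measurable_EFinP.
    + by apply/disj_setPS => x [[Bx _] [nBx _]].
  - move=> F tF HF; split; first by apply: bigcup_measurable => k _; have [] := HF k.
    rewrite setI_bigcupl integral_bigcup.
    + by apply: eseries0 => k _ _; have [_ ->] := HF k.
    + by apply: trivIset_setIr.
    + by move=> k; apply: measurableI => //; have [] := HF k.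
    + rewrite -setI_bigcupl; apply: iA; apply: bigcup_measurable => k _;
      have [] := HF k => //.
move=> mA; suff [] : H A by [].
have := @measurable_sub_locally_obox R d a b A mA.
rewrite -setI_closed_g_dynkin_g_sigma_algebra; last exact: setI_closed_locally_obox.
apply: smallest_sub => // B [mB [a' [b' BK]]]; split=> //.
by rewrite BK; exact: integral_obox.
Qed.

(** The integral of [u] vanishes over all measurable subsets of each cube, so [u]
    vanishes almost everywhere on the cube, and countably many cubes exhaust the
    space. *)
Lemma fundamental_lemma : {ae leb, forall x, u x = 0}.
Proof.
pose K n : set 'rV[R]_d := obox (fun=> - n%:R) (fun=> n%:R).
have aeK n : {ae leb, forall x, K n x -> (u x)%:E = 0%E}.
  have mK : measurable (K n) by exact: measurable_obox.
  apply: (@integral_ae_eq _ _ _ leb (K n) mK (cst 0%E) (EFin \o u)) => //.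
  - apply: (integrableS (measurable_cbox _ _) mK (@obox_cbox _ _ _ _)).
    exact: sqint_integrable su (measurable_cbox _ _) (lebesgue_cbox_lty _ _).
  - move=> E EK mE; rewrite integral0.
    by rewrite -(setIidl EK); exact: integral_measurable_obox.
have /ae_foralln : forall n, {ae leb, forall x, K n x -> (u x)%:E = 0%E} := aeK.
apply: filterS => x h.
pose M := \sum_i `|x ord0 i|.
have [n Mn] : exists n, M < n%:R.
  by exists (Num.bound M); apply: archi_boundP; exact: sumr_ge0.
apply: EFin_inj; apply: (h n) => i.
rewrite -ltr_norml; apply: le_lt_trans Mn.
by rewrite /M (bigD1 i)//= lerDl sumr_ge0.
Qed.

End vanishing.
End fundamental_lemma.

(** * Integrals over a moving window *)

Section moving_window.
Context {R : realType}.
Local Notation mu := (@lebesgue_measure R).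
Variables (f : R -> R) (a b : R).
Hypotheses (cf : continuous f) (sf : supported f a b).

Lemma supported_bounded : exists2 M, 0 <= M & forall t, `|f t| <= M.
Proof.
have [ab|ba] := leP a b; last first.
  exists 0 => // t; rewrite sf ?normr0//; apply/negP => /andP[at_ tb].
  by have := le_trans at_ tb; rewrite leNgt ba.
have cn : {within `[a, b], continuous (fun t => `|f t|)}.
  apply: continuous_subspaceT => t; apply: continuous_comp; first exact: cf.
  exact: norm_continuous.
have [c _ cM] := EVT_max ab cn.
exists `|f c| => // t; have [tab|tab] := boolP (t \in `[a, b]); first exact: cM.
by rewrite sf ?normr0//; move: tab; rewrite in_itv.
Qed.

Lemma supported_integrable : mu.-integrable setT (EFin \o f).
Proof.
have mab : measurable `[a, b]%classic by exact: measurable_itv.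
have -> : EFin \o f = (EFin \o f) \_ `[a, b].
  apply/funext => x; rewrite patchE; case: ifPn => //.
  by move/negP; rewrite inE /= in_itv /= => /negP /sf ->.
apply: (iffLR (integrable_mkcond (mu := mu) _ mab)).
by apply: continuous_compact_integrable;
  [exact: segment_compact|exact: continuous_subspaceT].
Qed.

Definition primitive (x : R) : R := \int[mu]_(t in `]-oo, x]) f t.

Lemma is_derive_primitive (x : R) : is_derive x 1 primitive (f x).
Proof.
have [] := @continuous_FTC1 R f -oo%O x (x + 1) _ _ _ (@cf x).
- by rewrite ltrDl.
- by apply: integrableS supported_integrable => //; exact: measurable_itv.
- by rewrite /= ltNyr.
by move=> dF <-; rewrite derive1E; exact: DeriveDef.
Qed.

Variable h : R.
Hypothesis h0 : 0 < h.

(** The integral of [f] over [t - h, t].  Unlike [primitive] it has bounded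
    support when [f] has, which makes it a legitimate factor of a test function. *)
Definition window (t : R) : R := primitive t - primitive (t - h).

Lemma is_derive_window (t : R) : is_derive t 1 window (f t - f (t - h)).
Proof.
have d2 : is_derive t 1 (fun t => primitive (t - h)) (f (t - h)).
  have dd : is_derive t 1 (fun t => t - h) 1.
    by have := is_derive_affine 1 (- h) t; under eq_fun do rewrite mul1r.
  have := @is_derive1_comp R primitive (fun t => t - h) t _ _
    (is_derive_primitive (t - h)) dd.
  by rewrite mulr1.
exact: (is_deriveB (is_derive_primitive t) d2).
Qed.

Lemma window_integral t : (\int[mu]_(s in `[0%R, h]) (f (t - s))%:E = (window t)%:E)%E.
Proof.
have cs : continuous (fun s => t - s).
  by move=> s; apply: continuousB; [exact: cvg_cst|exact: cvg_id].
have dF (s : R) : is_derive s 1 (fun s => - primitive (t - s)) (f (t - s)).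
  have dd : is_derive s 1 (fun s => t - s) (- 1).
    by have := is_derive_affine (-1) t s; under eq_fun do rewrite mulN1r addrC.
  have := is_deriveN (@is_derive1_comp R primitive (fun s => t - s) s _ _
    (is_derive_primitive (t - s)) dd).
  by rewrite mulrN1 opprK.
have cF : continuous (fun s => - primitive (t - s)) := is_derive_continuous dF.
rewrite (@continuous_FTC2 R (fun s => f (t - s)) (fun s => - primitive (t - s)) 0 h h0).
- by rewrite /window subr0 -EFinB opprK addrC.
- apply: continuous_subspaceT => s.
  by apply: (@continuous_comp _ _ _ (fun s => t - s) f); [exact: cs|exact: cf].
- split; first by move=> s _; have [] := dF s.
  + by apply: cvg_at_right_filter; exact: cF.
  + by apply: cvg_at_left_filter; exact: cF.
- by move=> s _; rewrite derive1E; exact: (@derive_val _ _ _ _ _ _ _ (dF s)).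
Qed.

Lemma supported_window : supported window a (b + h).
Proof.
move=> t tab; apply: EFin_inj; rewrite -window_integral integral0_eq// => s /=.
rewrite in_itv /= => /andP[s0 sh]; rewrite sf//; apply: contra tab => /andP[h1 h2].
by rewrite (le_trans h1) ?lerBlDr ?lerDl//= -lerBlDr (le_trans _ h2)// lerD2l lerN2.
Qed.

Lemma smooth1_window : smooth1 f -> smooth1 window.
Proof.
move=> smf; apply: smooth1_antiderivative is_derive_window => n.
apply: CdiffD; first exact: smf.
rewrite (_ : (fun _ => _) = (-1) \*: (fun t => f (1 * t + - h)));
  first by apply/CdiffZ/Cdiff_affine.
by apply/funext => t; rewrite /= mul1r scaleN1r.
Qed.

End moving_window.

(** * Square-integrable functions *)

Section cauchy_schwarz.
Context d (T : measurableType d) (R : realType) (mu : {measure set T -> \bar R}).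
Local Open Scope ereal_scope.

(** Cauchy-Schwarz against the constant 1: with [c] the mean value of [w], integrate
    [2 c w - c^2 <= w^2]. *)
Lemma sqr_integral_le (D : set T) (V : R) (w : T -> R) :
  measurable D -> mu D = V%:E -> (0 < V)%R -> measurable_fun D w ->
  (((\int[mu]_(s in D) w s) ^+ 2)%R)%:E <= V%:E * \int[mu]_(s in D) ((w s) ^+ 2)%:E.
Proof.
move=> mD DV V0 mw.
have mw2 : measurable_fun D (fun s => ((w s) ^+ 2)%:E).
  by apply/measurable_EFinP; exact: measurable_funX.
have [w2|] := ltP (\int[mu]_(s in D) ((w s) ^+ 2)%:E) +oo; last first.
  by rewrite leye_eq => /eqP ->; rewrite gt0_muley ?lte_fin// leey.
have iw2 : mu.-integrable D (EFin \o (fun s => (w s ^+ 2)%R)).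
  apply/integrableP; split => //.
  by under eq_integral => s _ do rewrite /= ger0_norm ?sqr_ge0//.
have i1 : forall k, mu.-integrable D (EFin \o (fun=> k)).
  move=> k; apply/integrableP; split; first exact/measurable_EFinP.
  by rewrite /= integral_cst// DV -EFinM ltry.
have iw : mu.-integrable D (EFin \o w).
  apply: (le_integrable mD) (integrableD mD (i1 1%R) iw2); first exact/measurable_EFinP.
  move=> s _ /=; rewrite lee_fin [leRHS]ger0_norm; last by rewrite addr_ge0 ?sqr_ge0.
  have : (0 <= (`|w s| - 1) ^+ 2)%R by exact: sqr_ge0.
  have : (0 <= `|w s|)%R by []. rewrite -[(w s ^+ 2)%R]real_normK ?num_real//. nra.
set m := (\int[mu]_(s in D) w s)%R.
have fw2 : \int[mu]_(s in D) ((w s) ^+ 2)%:E = ((\int[mu]_(s in D) (w s ^+ 2))%R)%:E.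
  by rewrite fineK//; exact: (integrable_fin_num mD iw2).
rewrite fw2 -EFinM lee_fin.
have i2 : mu.-integrable D (EFin \o (fun s => (2 * (m / V) * w s)%R)).
  exact: (integrableZl mD _ iw).
have : (\int[mu]_(s in D) (2 * (m / V) * w s - (m / V) ^+ 2) <=
        \int[mu]_(s in D) (w s ^+ 2))%R.
  apply: le_Rintegral => //.
    exact: (integrableB mD i2 (i1 _)).
  move=> s _; have := sqr_ge0 (w s - m / V); rewrite sqrrB; nra.
rewrite RintegralB// RintegralZl// -/m Rintegral_cst// DV /= => h.
rewrite -ler_pdivrMl//; apply: le_trans h; rewrite le_eqVlt; apply/orP; left; apply/eqP.
by field; rewrite gt_eqF.
Qed.

Lemma integral_norm_mul_le (u v : T -> R) :
  measurable_fun setT u -> measurable_fun setT v ->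
  \int[mu]_x `|u x * v x|%:E <= \int[mu]_x (u x ^+ 2)%:E + \int[mu]_x (v x ^+ 2)%:E.
Proof.
move=> mu' mv; rewrite -ge0_integralD//; last 4 first.
- by move=> x _; rewrite lee_fin sqr_ge0.
- by apply/measurable_EFinP; exact: measurable_funX.
- by move=> x _; rewrite lee_fin sqr_ge0.
- by apply/measurable_EFinP; exact: measurable_funX.
apply: ge0_le_integral => //.
- by apply/measurable_EFinP; apply: measurableT_comp => //; exact: measurable_funM.
- by apply: emeasurable_funD; apply/measurable_EFinP; exact: measurable_funX.
move=> x _; rewrite lee_fin normrM.
have : (0 <= (`|u x| - `|v x|) ^+ 2)%R by exact: sqr_ge0.
rewrite -[(u x ^+ 2)%R]real_normK ?num_real// -[(v x ^+ 2)%R]real_normK ?num_real//.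
have : (0 <= `|u x|)%R by []. have : (0 <= `|v x|)%R by []. nra.
Qed.
End cauchy_schwarz.

Section partial_integral.
Context d1 d2 (T1 : measurableType d1) (T2 : measurableType d2) (R : realType).
Variable m2 : {sigma_finite_measure set T2 -> \bar R}.
Local Open Scope ereal_scope.

Lemma measurable_fun_integral_snd (F : T1 * T2 -> \bar R) :
  measurable_fun setT F -> measurable_fun setT (fun x => \int[m2]_y F (x, y)).
Proof.
move=> mF; rewrite (_ : (fun x => _) =
  (fun x => \int[m2]_y F^\+ (x, y)) \- (fun x => \int[m2]_y F^\- (x, y))).
  apply: emeasurable_funB.
  - by apply: (measurable_fun_fubini_tonelli_F F^\+) => //; exact: measurable_funepos.
  - by apply: (measurable_fun_fubini_tonelli_F F^\-) => //; exact: measurable_funeneg.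
apply/funext => x; rewrite integralE; congr (_ - _); apply: eq_integral => y _.
  by rewrite (funepos_comp F (pair x)).
by rewrite (funeneg_comp F (pair x)).
Qed.
End partial_integral.

Section sqint_theory.
Context {R : realType} {d : nat}.
Local Notation leb := (lebesgue_rV R d).
Implicit Types (u v g : 'rV[R]_d -> R).

Lemma sqint_translation u (v : 'rV[R]_d) : sqint u -> sqint (fun x => u (x + v)).
Proof.
move=> [mu u2]; split; first exact: (measurableT_comp mu (measurable_rV_translation v)).
rewrite (ge0_integral_translation v (F := fun x => ((u x) ^+ 2)%:E))//.
  by apply/measurable_EFinP; exact: measurable_funX.
by move=> x; rewrite lee_fin sqr_ge0.
Qed.

Lemma ge0_integral_sqrD u v : measurable_fun setT u -> measurable_fun setT v ->
  (\int[leb]_x ((u x + v x) ^+ 2)%:E <=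
   2%:E * \int[leb]_x ((u x) ^+ 2)%:E + 2%:E * \int[leb]_x ((v x) ^+ 2)%:E)%E.
Proof.
move=> mu mv.
have mu2 : measurable_fun setT (fun x => ((u x) ^+ 2)%:E).
  by apply/measurable_EFinP; exact: measurable_funX.
have mv2 : measurable_fun setT (fun x => ((v x) ^+ 2)%:E).
  by apply/measurable_EFinP; exact: measurable_funX.
rewrite -!ge0_integralZl//; try by move=> x _; rewrite lee_fin sqr_ge0.
rewrite -ge0_integralD//; last 4 first.
- by move=> x _; rewrite -EFinM lee_fin mulr_ge0// sqr_ge0.
- exact: measurable_funeM.
- by move=> x _; rewrite -EFinM lee_fin mulr_ge0// sqr_ge0.
- exact: measurable_funeM.
apply: ge0_le_integral => //.
- by move=> x _; rewrite lee_fin sqr_ge0.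
- by apply/measurable_EFinP; apply: measurable_funX; exact: measurable_funD.
- by apply: emeasurable_funD; exact: measurable_funeM.
- by move=> x _; rewrite -!EFinM -EFinD lee_fin; have := sqr_ge0 (u x - v x); nra.
Qed.

Lemma sqintB u v : sqint u -> sqint v -> sqint (fun x => u x - v x).
Proof.
move=> [mu u2] [mv v2]; split; first exact: measurable_funB.
apply: le_lt_trans (ge0_integral_sqrD mu (measurable_funN mv)) _.
under [X in (_ + _ * X)%E]eq_integral do rewrite sqrrN.
by rewrite lte_add_pinfty// lte_mul_pinfty.
Qed.

Lemma test_tensor_bounded phi a b : test_tensor phi a b ->
  exists2 M, 0 <= M & forall x : 'rV[R]_d, `|tensor phi x| <= M.
Proof.
move=> [smphi sphi].
have /choice[M HM] : forall i, exists m, 0 <= m /\ forall t, `|phi i t| <= m.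
  move=> i; have [m m0 mP] := supported_bounded (smphi i 0%N) (sphi i).
  by exists m.
exists (\prod_i M i); first by apply: prodr_ge0 => i _; have [] := HM i.
move=> x; rewrite /tensor normr_prod; apply: ler_prod => i _.
by rewrite normr_ge0; have [_ ->] := HM i.
Qed.

Lemma measurable_test_tensor phi a b : test_tensor phi a b ->
  measurable_fun [set: 'rV[R]_d] (tensor phi).
Proof. by move=> [smphi _]; apply: measurable_tensor => i; exact: (smphi i 0%N). Qed.

Lemma sqint_tensor (phi : 'I_d -> R -> R) a b :
  test_tensor phi a b -> sqint (tensor phi).
Proof.
move=> tphi; have [M M0 HM] := test_tensor_bounded tphi.
have mphi := measurable_test_tensor tphi; split => //.
rewrite (_ : (fun x => _) = (fun x => ((tensor phi x) ^+ 2)%:E) \_ (cbox a b));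
  last first.
  apply/funext => x; rewrite patchE; case: ifPn => //.
  by move/negP; rewrite inE => /(tensor_out tphi.2) /= ->; rewrite expr0n.
rewrite -integral_mkcond.
apply: (@le_lt_trans _ _ (\int[leb]_(x in cbox a b) (M ^+ 2)%:E)%E).
  apply: ge0_le_integral => //.
  - exact: measurable_cbox.
  - by move=> x _; rewrite lee_fin sqr_ge0.
  - by apply/measurable_funTS/measurable_EFinP; exact: measurable_funX.
  - by move=> x _; rewrite lee_fin -[leLHS]real_normK ?num_real// lerXn2r ?nnegrE.
rewrite integral_cst; last exact: measurable_cbox.
by rewrite lte_mul_pinfty ?lee_fin ?sqr_ge0// lebesgue_cbox_lty.
Qed.

Lemma integrable_mul_tensor u phi a b : sqint u -> test_tensor phi a b ->
  leb.-integrable setT (EFin \o (fun x => u x * tensor phi x)).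
Proof.
move=> su tphi; have [M M0 HM] := test_tensor_bounded tphi.
apply: (sqint_integrable_mul su (measurable_test_tensor tphi) HM).
by move=> x; exact: (tensor_out tphi.2).
Qed.
End sqint_theory.

(** * Difference quotients of weak derivatives *)

Section difference_quotient.
Context {R : realType} {d : nat}.
Local Notation leb := (lebesgue_rV R d).
Local Notation mu := (@lebesgue_measure R).
Local Notation RT := (measurableTypeR R).
Variable i : 'I_d.
Local Notation e := (delta_mx ord0 i : 'rV[R]_d).

Lemma measurable_slide (c : R) :
  measurable_fun [set: 'rV[R]_d * RT] (fun xs => xs.1 + (c * xs.2) *: e).
Proof.
apply: measurable_fun_rVP => j.
under eq_fun do rewrite !mxE.
apply: measurable_funD.
  exact: (measurableT_comp (measurable_coord j) measurable_fst).
apply: measurable_funM => //.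
by apply: measurable_funM => //; exact: measurable_snd.
Qed.

Variables (h : R) (h0 : 0 < h).
Local Notation D := (`[0, h]%classic : set RT).

Let mD : measurable D. Proof. exact: measurable_itv. Qed.

Let muD : mu D = h%:E.
Proof. by rewrite lebesgue_measure_itv /= lte_fin h0 sube0. Qed.

(** The integral of [g] over the segment from [x] to [x + h e_i]: when [g] is the
    derivative of [u] along [e_i], it equals [u (x + h e_i) - u x]. *)
Definition segment_integral (g : 'rV[R]_d -> R) (x : 'rV[R]_d) : R :=
  \int[mu]_(s in D) g (x + s *: e).

Section sqint_line.
Variable g : 'rV[R]_d -> R.
Hypothesis sg : sqint g.
Let mg : measurable_fun setT g := sg.1.

Let mgs : measurable_fun [set: 'rV[R]_d * RT] (fun xs => g (xs.1 + xs.2 *: e)).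
Proof.
have := measurableT_comp mg (measurable_slide 1).
by rewrite (_ : _ \o _ = (fun xs => g (xs.1 + xs.2 *: e)))//;
  apply/funext => xs /=; rewrite mul1r.
Qed.

Let m1D : measurable_fun [set: 'rV[R]_d * RT] (fun xs => \1_D xs.2 : R).
Proof. exact: (measurableT_comp (measurable_indic mD) measurable_snd). Qed.

Lemma measurable_segment_integral : measurable_fun setT (segment_integral g).
Proof.
pose F (xs : 'rV[R]_d * RT) := (g (xs.1 + xs.2 *: e) * \1_D xs.2)%:E.
have mF : measurable_fun setT F by apply/measurable_EFinP; exact: measurable_funM.
have := measurable_fun_integral_snd mu mF.
rewrite (_ : (fun x => _) = (fun x => (\int[mu]_(s in D) (g (x + s *: e))%:E)%E)).
  by move=> mI; apply: (measurableT_comp _ mI); exact: fine_measurable.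
apply/funext => x; rewrite [RHS]integral_mkcond; apply: eq_integral => s _.
by rewrite /F /= patchE indicE; case: ifP => _; rewrite ?mulr1 ?mulr0.
Qed.

(** Cauchy-Schwarz on each segment, then Tonelli and translation invariance. *)
Lemma integral_segment_integral_sqr :
  (\int[leb]_x ((segment_integral g x) ^+ 2)%:E <=
   (h ^+ 2)%:E * \int[leb]_x ((g x) ^+ 2)%:E)%E.
Proof.
have mg2 : measurable_fun setT (fun x => ((g x) ^+ 2)%:E).
  by apply/measurable_EFinP; exact: measurable_funX.
pose F (xs : 'rV[R]_d * RT) := ((g (xs.1 + xs.2 *: e)) ^+ 2 * \1_D xs.2)%:E.
have mF : measurable_fun setT F.
  by apply/measurable_EFinP; apply: measurable_funM => //; exact: measurable_funX.
have F0 xs : (0 <= F xs)%E by rewrite lee_fin mulr_ge0 ?sqr_ge0.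
apply: (@le_trans _ _ (\int[leb]_x (h%:E * \int[mu]_s F (x, s)))%E).
  apply: ge0_le_integral => //.
  - by move=> x _; rewrite lee_fin sqr_ge0.
  - apply/measurable_EFinP; apply: measurable_funX; exact: measurable_segment_integral.
  - by apply: measurable_funeM; exact: (measurable_fun_integral_snd mu).
  move=> x _.
  have -> : (\int[mu]_s F (x, s) = \int[mu]_(s in D) ((g (x + s *: e)) ^+ 2)%:E)%E.
    rewrite [RHS]integral_mkcond; apply: eq_integral => s _.
    by rewrite /F /= patchE indicE; case: ifP => _; rewrite ?mulr1 ?mulr0.
  apply: sqr_integral_le => //.
  apply: measurable_funTS.
  exact: (measurableT_comp mgs (pair1_measurable x)).
rewrite ge0_integralZl//; last 3 first.
- exact: (measurable_fun_integral_snd mu).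
- by move=> x _; apply: integral_ge0.
- by rewrite lee_fin ltW.
rewrite (fubini_tonelli F)// expr2 EFinM -muleA.
apply: lee_wpmul2l; first by rewrite lee_fin ltW.
rewrite (_ : (fun s => _) = (fun s : RT =>
  (\1_D s)%:E * \int[leb]_x ((g x) ^+ 2)%:E)%E).
  rewrite ge0_integralZr//; last 2 first.
  - by apply/measurable_EFinP; exact: measurable_indic.
  - by apply: integral_ge0 => x _; rewrite lee_fin sqr_ge0.
  by rewrite integral_indic// setIT -muD; exact: lexx.
apply/funext => s; rewrite /F /=.
under eq_integral do rewrite EFinM.
rewrite ge0_integralZr//; last 2 first.
- apply/measurable_EFinP; apply: measurable_funX.
  exact: (measurableT_comp mg (measurable_rV_translation _)).
- by move=> x _; rewrite lee_fin sqr_ge0.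
rewrite muleC (ge0_integral_translation (s *: e) mg2)// => x.
by rewrite lee_fin sqr_ge0.
Qed.

Lemma sqint_segment_integral : sqint (segment_integral g).
Proof.
split; first exact: measurable_segment_integral.
apply: le_lt_trans integral_segment_integral_sqr _.
by rewrite lte_mul_pinfty ?lee_fin ?sqr_ge0//; exact: sg.2.
Qed.

End sqint_line.
End difference_quotient.

Section weak_derivative.
Context {R : realType} {d : nat}.
Local Notation leb := (lebesgue_rV R d).
Local Notation mu := (@lebesgue_measure R).
Local Notation RT := (measurableTypeR R).

(** The real form of [weak_partial]: the real and imaginary parts of a function and
    of its weak derivative satisfy it. *)
Definition weak_deriv (i : 'I_d) (u g : 'rV[R]_d -> R) : Prop :=
  forall phi, test_function phi ->
    \int[leb]_x (u x * partial i phi x) = - \int[leb]_x (g x * phi x).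

Variable i : 'I_d.
Local Notation e := (delta_mx ord0 i : 'rV[R]_d).
Variables (h : R) (h0 : 0 < h).
Local Notation D := (`[0, h]%classic : set RT).

Let mD : measurable D. Proof. exact: measurable_itv. Qed.

Let muD : mu D = h%:E.
Proof. by rewrite lebesgue_measure_itv /= lte_fin h0 sube0. Qed.

Lemma tensor_slide phi (x : 'rV[R]_d) s :
  tensor phi (x + s *: e) = phi i (x ord0 i + s) * \prod_(j | j != i) phi j (x ord0 j).
Proof.
rewrite (tensorE _ i) addrC coord_shift eqxx [s + _]addrC; congr (_ * _).
by apply: eq_bigr => j /negbTE ji; rewrite coord_shift ji.
Qed.

(** The adjoint of integrating forwards along [e_i] is integrating backwards, which
    replaces the factor of index [i] of a tensor product by its window. *)
Lemma fubini_segment_integral g phi a b : sqint g -> test_tensor phi a b ->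
  \int[leb]_x (segment_integral i h g x * tensor phi x) =
  \int[leb]_x (g x * tensor (subst_at i (window (phi i) h) phi) x).
Proof.
move=> sg tphi.
have mg : measurable_fun setT g := sg.1.
have sphi := sqint_tensor tphi.
have mphi : measurable_fun setT (tensor phi) := sphi.1.
have m1D : measurable_fun [set: 'rV[R]_d * RT] (fun xs => \1_D xs.2 : R).
  exact: (measurableT_comp (measurable_indic mD) measurable_snd).
pose F1 (xs : 'rV[R]_d * RT) := (g (xs.1 + xs.2 *: e) * tensor phi xs.1 * \1_D xs.2)%:E.
pose F2 (xs : 'rV[R]_d * RT) := (g xs.1 * tensor phi (xs.1 - xs.2 *: e) * \1_D xs.2)%:E.
have mslide (c : R) (f : 'rV[R]_d -> R) : measurable_fun setT f ->
    measurable_fun [set: 'rV[R]_d * RT] (fun xs => f (xs.1 + (c * xs.2) *: e)).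
  by move=> mf; exact: (measurableT_comp mf (measurable_slide i c)).
have mfst (f : 'rV[R]_d -> R) : measurable_fun setT f ->
    measurable_fun [set: 'rV[R]_d * RT] (fun xs => f xs.1).
  by move=> mf; exact: (measurableT_comp mf measurable_fst).
have mF1 : measurable_fun setT F1.
  apply/measurable_EFinP; apply: measurable_funM => //; apply: measurable_funM;
    last exact: mfst.
  by have := mslide 1 _ mg; under eq_fun do rewrite mul1r.
have mF2 : measurable_fun setT F2.
  apply/measurable_EFinP; apply: measurable_funM => //; apply: measurable_funM;
    first exact: mfst.
  by have := mslide (-1) _ mphi; under eq_fun do rewrite mulN1r scaleNr.
(* F1 (., s) is the translate of F2 (., s) by s e_i *)
have F12 s : (\int[leb]_x F1 (x, s) = \int[leb]_x F2 (x, s))%E.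
  rewrite -[RHS](integral_translation (s *: e)).
    by apply: eq_integral => x _; rewrite /F1 /F2 /= addrK.
  exact: (measurableT_comp mF2 (pair2_measurable _)).
have F12a s : (\int[leb]_x `|F1 (x, s)| = \int[leb]_x `|F2 (x, s)|)%E.
  rewrite -[RHS](ge0_integral_translation (s *: e)).
  - by apply: eq_integral => x _; rewrite /F1 /F2 /= addrK.
  - apply: measurableT_comp => //; exact: (measurableT_comp mF2 (pair2_measurable _)).
  - by [].
pose C := (\int[leb]_x ((g x) ^+ 2)%:E + \int[leb]_x ((tensor phi x) ^+ 2)%:E)%E.
have C0 : (0 <= C)%E by apply: adde_ge0; apply: integral_ge0 => x _;
  rewrite lee_fin sqr_ge0.
have Coo : (C < +oo)%E by apply: lte_add_pinfty; [exact: sg.2|exact: sphi.2].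
have F1C s : (\int[leb]_x `|F1 (x, s)| <= C * (\1_D s)%:E)%E.
  rewrite /F1 /=; under eq_integral do rewrite normrM EFinM [`|\1_D s|]ger0_norm//.
  have mgs : measurable_fun setT (fun x : 'rV[R]_d => g (x + s *: e)).
    exact: (measurableT_comp mg (measurable_rV_translation _)).
  rewrite ge0_integralZr//; last first.
    by apply/measurable_EFinP; apply: measurableT_comp => //; exact: measurable_funM.
  apply: lee_wpmul2r; first by rewrite lee_fin.
  apply: le_trans (integral_norm_mul_le leb mgs mphi) _.
  rewrite (ge0_integral_translation (s *: e) (F := fun x => ((g x) ^+ 2)%:E))//.
    by apply/measurable_EFinP; exact: measurable_funX.
  by move=> x; rewrite lee_fin sqr_ge0.
have I1oo : (\int[mu]_s \int[leb]_x `|F1 (x, s)| < +oo)%E.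
  apply: (@le_lt_trans _ _ (\int[mu]_s (C * (\1_D s)%:E))%E).
    apply: ge0_le_integral => //.
    - by move=> s _; apply: integral_ge0.
    - apply: (measurable_fun_fubini_tonelli_G (abse \o F1)) => //.
        exact: measurableT_comp.
      by move=> z; exact: abse_ge0.
    - by apply: measurable_funeM; apply/measurable_EFinP; exact: measurable_indic.
  rewrite ge0_integralZl//.
  - rewrite integral_indic// setIT; apply: lte_mul_pinfty => //.
      by rewrite ge0_fin_numE.
    by rewrite [X in (X < _)%E]muD ltry.
  - by apply/measurable_EFinP; exact: measurable_indic.
have iF1 : (leb \x mu)%E.-integrable setT F1 by apply/integrable21ltyP.
have iF2 : (leb \x mu)%E.-integrable setT F2.
  by apply/integrable21ltyP => //; under eq_integral do rewrite -F12a.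
have swap : (\int[leb]_x \int[mu]_s F1 (x, s) = \int[leb]_x \int[mu]_s F2 (x, s))%E.
  rewrite (Fubini iF1) (Fubini iF2); apply: eq_integral => s _; exact: F12.
have inner2 x : (\int[mu]_s F2 (x, s) =
    (g x * tensor (subst_at i (window (phi i) h) phi) x)%:E)%E.
  rewrite tensor_subst_at; set c := \prod_(j | j != i) _.
  transitivity (\int[mu]_(s in D) ((g x * c)%:E * (phi i (x ord0 i - s))%:E))%E.
    rewrite [RHS]integral_mkcond; apply: eq_integral => s _.
    rewrite /F2 /= patchE indicE -scaleNr tensor_slide -/c.
    by case: ifP => _; rewrite ?mulr0// mulr1 -EFinM; congr EFin; ring.
  have ci : continuous (phi i) := tphi.1 i 0%N.
  rewrite integralZl//; last first.
    apply: continuous_compact_integrable; first exact: segment_compact.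
    apply: continuous_subspaceT => s.
    apply: (@continuous_comp _ _ _ (fun s => x ord0 i - s) (phi i)); last exact: ci.
    by apply: continuousB; [exact: cvg_cst|exact: cvg_id].
  by rewrite (window_integral ci (tphi.2 i) h0) -EFinM; congr EFin; ring.
(* where the tensor product is nonzero, integrability of F1 (x, .) is that
   of g on the segment, and the constant factor can be moved out *)
have inner1 : {ae leb, forall x, setT x -> (\int[mu]_s F1 (x, s))%E =
  (segment_integral i h g x * tensor phi x)%:E}.
  have := ae_integrable1 iF1; apply: filterS => x iFx _.
  have [p0|p0] := eqVneq (tensor phi x) 0.
    by rewrite p0 mulr0 integral0_eq// => s _; rewrite /F1 /= p0 mulr0 mul0r.
  have E s : F1 (x, s) = (((fun s => (g (x + s *: e) * tensor phi x)%:E) \_ D) s).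
    by rewrite /F1 /= patchE indicE; case: ifP => _; rewrite ?mulr1 ?mulr0.
  have iD : mu.-integrable D (EFin \o (fun s => g (x + s *: e) * tensor phi x)).
    apply: (iffRL (integrable_mkcond (mu := mu) _ mD)).
    by apply: eq_integrable iFx => // s _; rewrite E.
  have ig : mu.-integrable D (EFin \o (fun s => g (x + s *: e))).
    have := integrableZr mD (tensor phi x)^-1 iD.
    apply: eq_integrable => // s _ /=.
    by rewrite -EFinM mulfK.
  under eq_integral do rewrite E.
  rewrite -integral_mkcond -RintegralZr// fineK//.
  exact: (integrable_fin_num mD iD).
have E : (\int[leb]_x (segment_integral i h g x * tensor phi x)%:E =
    \int[leb]_x (g x * tensor (subst_at i (window (phi i) h) phi) x)%:E)%E.
  rewrite -(eq_integral _ _ (fun x _ => inner2 x)) -swap.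
  apply/esym/ae_eq_integral => //.
  - exact: measurable_fun_integral_snd.
  - apply/measurable_EFinP; apply: measurable_funM => //.
    exact: measurable_segment_integral.
by rewrite /Rintegral E.
Qed.
End weak_derivative.

Section difference_of_weak_derivative.
Context {R : realType} {d : nat}.
Local Notation leb := (lebesgue_rV R d).
Variables (i : 'I_d) (u g : 'rV[R]_d -> R) (h : R).
Hypotheses (su : sqint u) (sg : sqint g) (ug : weak_deriv i u g) (h0 : 0 < h).
Local Notation e := (delta_mx ord0 i : 'rV[R]_d).

(** The fundamental theorem of calculus for weak derivatives.  The derivative
    along [e_i] of the windowed tensor product is [phi x - phi (x - h e_i)]; testing
    the weak derivative against the former gives, by [fubini_segment_integral] and a
    translation, equality of both sides tested against [phi]. *)
Lemma weak_deriv_difference :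
  {ae leb, forall x, u (x + h *: e) - u x - segment_integral i h g x = 0}.
Proof.
have suh := sqint_translation (h *: e) su.
have sG := sqint_segment_integral i h0 sg.
apply: fundamental_lemma; first exact: sqintB (sqintB suh su) sG.
move=> phi a b tphi; have [smphi pphi] := tphi.
pose w := window (phi i) h.
have cphi : continuous (phi i) := smphi i 0%N.
have tw : test_tensor (subst_at i w phi) a (fun j => if j == i then b j + h else b j).
  split=> j; rewrite /subst_at; case: eqP => [ji|_] //; rewrite ?ji.
  - exact: (smooth1_window cphi (pphi i)).
  - exact: (supported_window cphi (pphi i) h0).
have iu := integrable_mul_tensor su tphi.
have iuh := integrable_mul_tensor suh tphi.
have iG := integrable_mul_tensor sG tphi.
have iut : leb.-integrable setT (EFin \o (fun x => u x * tensor phi (x - h *: e))).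
  have := integrable_translation (- (h *: e)) iuh.
  by apply: eq_integrable => // x _ /=; rewrite subrK.
have E1 : \int[leb]_x (u x * partial i (tensor (subst_at i w phi)) x) =
    \int[leb]_x (u x * tensor phi x) - \int[leb]_x (u x * tensor phi (x - h *: e)).
  rewrite -RintegralB//; apply: eq_Rintegral => x _.
  rewrite -mulrBr; congr (_ * _).
  have dw (t : R) : is_derive t 1 (subst_at i w phi i) (phi i t - phi i (t - h)).
    by rewrite /subst_at eqxx; exact: (is_derive_window cphi (pphi i)).
  rewrite /partial (@derive_val _ _ _ _ _ _ _ (is_derive_tensor x dw)) tensor_subst_at.
  rewrite -scaleNr tensor_slide (tensorE phi i) -mulrBl; congr (_ * _).
  by apply: eq_bigr => j /negbTE ji; rewrite /subst_at ji.
have E2 : \int[leb]_x (u x * tensor phi (x - h *: e)) =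
    \int[leb]_x (u (x + h *: e) * tensor phi x).
  rewrite -[LHS](Rintegral_translation (h *: e)).
    by apply: eq_Rintegral => x _; rewrite addrK.
  by move/measurable_int: iut => /measurable_EFinP.
have := ug (test_function_tensor tw.1 tw.2).
rewrite E1 E2 -(fubini_segment_integral i h0 sg tphi) => /eqP;
  rewrite -subr_eq0 opprK => /eqP E3.
under eq_Rintegral do rewrite !mulrBl.
rewrite RintegralB//; last exact: (integrableB measurableT iuh iu).
rewrite RintegralB//; lra.
Qed.

Lemma weak_deriv_difference_le :
  (\int[leb]_x ((u (x + h *: e) - u x) ^+ 2)%:E <=
   (h ^+ 2)%:E * \int[leb]_x ((g x) ^+ 2)%:E)%E.
Proof.
apply: le_trans (integral_segment_integral_sqr i h0 sg).
have [suh _] := sqint_translation (h *: e) su.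
have [mG _] := sqint_segment_integral i h0 sg.
rewrite le_eqVlt; apply/orP; left; apply/eqP; apply: ae_eq_integral => //.
- by apply/measurable_EFinP; apply: measurable_funX; apply: measurable_funB => //;
  exact: su.1.
- by apply/measurable_EFinP; exact: measurable_funX.
have := weak_deriv_difference; apply: filterS => x + _.
by move=> /eqP; rewrite subr_eq0 => /eqP ->.
Qed.

End difference_of_weak_derivative.

(** * Weak-type estimates and the subcritical exponents *)

Lemma markov_set d (T : measurableType d) (R : realType)
    (mu : {measure set T -> \bar R}) (E : set T) (c : R) (F : T -> \bar R) :
  measurable E -> 0 <= c -> measurable_fun setT F -> (forall x, 0 <= F x)%E ->
  (forall x, E x -> (c%:E <= F x)%E) ->
  (c%:E * mu E <= \int[mu]_x F x)%E.
Proof.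
move=> mE c0 mF F0 cF.
rewrite -[mu E]/(mu E) -(setIT E) -integral_indic// -ge0_integralZl//; last first.
  by apply/measurable_EFinP; exact: measurable_indic.
apply: ge0_le_integral => //.
- by move=> x _; rewrite -EFinM lee_fin mulr_ge0.
- by apply: measurable_funeM; apply/measurable_EFinP; exact: measurable_indic.
- move=> x _; rewrite indicE; case: (boolP (x \in E)) => [|_]; last by rewrite mule0.
  by rewrite inE mule1 => /cF.
Qed.

Section weak_type.
Context {R : realType} {d : nat}.
Local Notation leb := (lebesgue_rV R d).
Implicit Types (u : 'rV[R]_d -> R).

(** The L^2 modulus of continuity of [u] is linear; among the consequences of
    having a weak gradient, only this one enters the embedding. *)
Definition translation_bound u (C : R) := 0 <= C /\
  forall (r : R) y, 0 <= r -> cube r y ->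
    (\int[leb]_x ((u (x + y) - u x) ^+ 2)%:E <= (C * r ^+ 2)%:E)%E.

(** Go from [x] to [x + y] along one coordinate axis after the other. *)
Lemma weak_deriv_translation_bound u (g : 'I_d -> 'rV[R]_d -> R) :
  sqint u -> (forall i, sqint (g i)) -> (forall i, weak_deriv i u (g i)) ->
  exists C, translation_bound u C.
Proof.
move=> su sg ug; have mu := su.1.
(* induction on the list of coordinates along which one has moved *)
suff [C [C0 HC]] : exists C, 0 <= C /\
    forall (r : R) (y : 'rV[R]_d), 0 <= r -> cube r y ->
    (\int[leb]_x ((u (x + \sum_(i <- enum 'I_d) y ord0 i *: delta_mx ord0 i) - u x)
      ^+ 2)%:E <= (C * r ^+ 2)%:E)%E.
  exists C; split=> // r y r0 ry; have := HC r y r0 ry.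
  by rewrite big_enum /= -row_sum_delta.
elim: (enum 'I_d) => [|i s [C [C0 HC]]].
  exists 0; split=> // r y _ _; rewrite mul0r integral0_eq// => x _.
  by rewrite big_nil addr0 subrr expr0n.
pose G := fine (\int[leb]_x ((g i x) ^+ 2)%:E).
have G0 : 0 <= G by apply: fine_ge0; apply: integral_ge0 => x _;
  rewrite lee_fin sqr_ge0.
have GE : (\int[leb]_x ((g i x) ^+ 2)%:E)%E = G%:E.
  rewrite fineK// ge0_fin_numE; first exact: (sg i).2.
  by apply: integral_ge0 => x _; rewrite lee_fin sqr_ge0.
exists (2 * G + 2 * C); split; first by rewrite addr_ge0// mulr_ge0.
move=> r y r0 ry.
pose z : 'rV[R]_d := \sum_(j <- s) y ord0 j *: delta_mx ord0 j.
pose w : 'rV[R]_d := y ord0 i *: delta_mx ord0 i.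
have /andP[y0 yr] := ry i.
have muw : measurable_fun setT (fun x : 'rV[R]_d => u (x + w) - u x).
  by apply: measurable_funB => //;
    exact: (measurableT_comp mu (measurable_rV_translation w)).
have muz : measurable_fun setT (fun x : 'rV[R]_d => u (x + z) - u x).
  by apply: measurable_funB => //;
    exact: (measurableT_comp mu (measurable_rV_translation z)).
have -> : (\int[leb]_x
      ((u (x + \sum_(j <- i :: s) y ord0 j *: delta_mx ord0 j) - u x) ^+ 2)%:E =
    \int[leb]_x ((u (x + z + w) - u (x + z) + (u (x + z) - u x)) ^+ 2)%:E)%E.
  by apply: eq_integral => x _; rewrite big_cons -/z -/w [w + z]addrC addrA addrA subrK.
apply: le_trans (ge0_integral_sqrD _ _) _ => //.
  exact: (measurableT_comp muw (measurable_rV_translation z)).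
rewrite (ge0_integral_translation z (F := fun x => ((u (x + w) - u x) ^+ 2)%:E));
  last 2 first.
- by apply/measurable_EFinP; exact: measurable_funX.
- by move=> x; rewrite lee_fin sqr_ge0.
have h1 : (\int[leb]_x ((u (x + w) - u x) ^+ 2)%:E <= (G * r ^+ 2)%:E)%E.
  move: y0; rewrite le_eqVlt => /predU1P[y0|y0].
    rewrite integral0_eq ?lee_fin ?mulr_ge0 ?exprn_ge0// => x _.
    by rewrite /w -y0 scale0r addr0 subrr expr0n.
  apply: le_trans (weak_deriv_difference_le su (sg i) (ug i) y0) _.
  rewrite GE -EFinM lee_fin mulrC ler_wpM2l// lerXn2r// nnegrE ?ltW//.
rewrite mulrDl -!mulrA [leRHS]EFinD; apply: leeD; rewrite [leRHS]EFinM;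
  apply: lee_wpmul2l => //.
exact: HC.
Qed.

(** The Marcinkiewicz condition: [u] belongs to weak L^r. *)
Definition weak_type u (r : R) := exists2 M, 0 < M &
  forall t, 0 < t -> (leb [set x | (t < `|u x|)%R] <= (M * t `^ (- r))%:E)%E.

Lemma measurable_superlevel u t : measurable_fun setT u ->
  measurable [set x | t < `|u x|].
Proof.
move=> mu; have mn : measurable_fun setT (fun x => `|u x|) by exact: measurableT_comp.
have := mn measurableT `]t, +oo[%classic (measurable_itv _); rewrite setTI.
by congr measurable; apply/seteqP; split => x /=; rewrite in_itv /= andbT.
Qed.

Lemma weak_type2 u : sqint u -> weak_type u 2.
Proof.
move=> [mu u2].
have I0 : (0 <= \int[leb]_x ((u x) ^+ 2)%:E)%E by apply: integral_ge0 => x _;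
  rewrite lee_fin sqr_ge0.
pose I := fine (\int[leb]_x ((u x) ^+ 2)%:E).
have IE : (\int[leb]_x ((u x) ^+ 2)%:E)%E = I%:E by rewrite fineK// ge0_fin_numE.
exists (I + 1) => [|t t0]; first by rewrite ltr_wpDl// fine_ge0.
rewrite powRN powR_mulrn ?(ltW t0)// EFinM lee_pdivlMr ?exprn_gt0//.
apply: (@le_trans _ _ I%:E); last by rewrite lee_fin lerDl.
rewrite -IE muleC; apply: markov_set.
- exact: measurable_superlevel.
- by rewrite exprn_ge0// ltW.
- by apply/measurable_EFinP; exact: measurable_funX.
- by move=> x; rewrite lee_fin sqr_ge0.
move=> x /= tx; rewrite lee_fin -[leRHS]real_normK ?num_real// lerXn2r// ?nnegrE ltW//.
Qed.

(** Where [|u x| > t], half of the translates [u (x + y)], [y] in a cube [Q] of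
    well-chosen size, are at most [t / 2] in modulus, so [u (x + y) - u x] is large
    there; but in the mean over [x] it is small, by the modulus of continuity. *)
Lemma weak_type_step u C r : (0 < d)%N -> 0 < r -> measurable_fun setT u ->
  translation_bound u C -> weak_type u r -> weak_type u (2 + 2 * r / d%:R).
Proof.
move=> d0 r0 mu [C0 HC] [M M0 HM].
have D0 : 0 < d%:R :> R by rewrite ltr0n.
pose K : R := (2 * M * 2 `^ r) `^ (2 / d%:R).
have B0 : 0 < 2 * M * 2 `^ r by rewrite !mulr_gt0// powR_gt0.
have K0 : 0 < K by exact: powR_gt0.
exists (8 * C * K + 1) => [|t t0]; first by rewrite ltr_wpDl// !mulr_ge0// ltW.
(* volume of the cube: twice the bound on the measure of |u| > t / 2 *)
pose V := 2 * M * (t / 2) `^ (- r).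
have t2 : 0 < t / 2 by rewrite divr_gt0.
have V0 : 0 < V by rewrite mulr_gt0 ?powR_gt0// mulr_gt0.
pose s := V `^ (d%:R^-1).
have s0 : 0 < s by exact: powR_gt0.
have sV : s ^+ d = V.
  by rewrite -powR_mulrn ?(ltW s0)// -powRrM mulVf ?gt_eqF// powRr1 ?ltW.
have s2 : s ^+ 2 = K * t `^ (- (2 * r / d%:R)).
  have VE : V = (2 * M * 2 `^ r) * t `^ (- r).
    rewrite /V powRM ?invr_ge0 ?(ltW t0)//.
    have -> : (2^-1 : R) = 2 `^ (-1) by rewrite powR_inv1.
    by rewrite -powRrM mulN1r opprK mulrA mulrAC.
  rewrite -powR_mulrn ?(ltW s0)// -powRrM VE powRM ?powR_ge0 ?(ltW B0)//.
  by rewrite -powRrM /K; congr (_ `^ _ * _ `^ _); field; rewrite gt_eqF.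
pose Q := @cube R d s.
have mQ : measurable Q by exact: measurable_cube.
have QV : leb Q = V%:E by rewrite lebesgue_cube ?sV ?ltW.
(* the square of the difference, to be integrated in both orders *)
pose H (xy : 'rV[R]_d * 'rV[R]_d) := ((u (xy.1 + xy.2) - u xy.1) ^+ 2 * \1_Q xy.2)%:E.
have mH : measurable_fun setT H.
  have mD : measurable_fun [set: 'rV[R]_d * 'rV[R]_d] (fun xy => xy.1 + xy.2).
    apply: measurable_fun_rVP => i; under eq_fun do rewrite mxE.
    apply: measurable_funD; first exact: (measurableT_comp
      (measurable_coord i) measurable_fst).
    exact: (measurableT_comp (measurable_coord i) measurable_snd).
  apply/measurable_EFinP; apply: measurable_funM; last first.
    exact: (measurableT_comp (measurable_indic mQ) measurable_snd).
  apply: measurable_funX; apply: measurable_funB; first exact: (measurableT_comp mu mD).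
  exact: (measurableT_comp mu measurable_fst).
have H0 xy : (0 <= H xy)%E by rewrite lee_fin mulr_ge0 ?sqr_ge0.
have Hle : (\int[leb]_x \int[leb]_y H (x, y) <= (C * s ^+ 2 * V)%:E)%E.
  rewrite (fubini_tonelli H)//.
  apply: (@le_trans _ _ (\int[leb]_y ((C * s ^+ 2)%:E * (\1_Q y)%:E))%E).
    apply: ge0_le_integral => //.
    - by move=> y _; apply: integral_ge0.
    - exact: (measurable_fun_fubini_tonelli_G H).
    - by apply: measurable_funeM; apply/measurable_EFinP; exact: measurable_indic.
    move=> y _; rewrite /H /= indicE; have [yQ|yQ] := boolP (y \in Q); last first.
      by rewrite mule0 integral0_eq// => x _; rewrite mulr0.
    under eq_integral do rewrite mulr1.
    by rewrite mule1; apply: HC; [exact: ltW|rewrite inE in yQ].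
  rewrite ge0_integralZl//; last first.
  - by rewrite lee_fin mulr_ge0// sqr_ge0.
  - by apply/measurable_EFinP; exact: measurable_indic.
  by rewrite integral_indic// setIT [leRHS]EFinM -QV; exact: lexx.
have Hge x : t < `|u x| -> ((t ^+ 2 * V / 8)%:E <= \int[leb]_y H (x, y))%E.
  move=> tx.
  pose A := Q `&` [set y | `|u (x + y)| <= t / 2].
  pose B := [set y | t / 2 < `|u (x + y)|].
  have mux : measurable_fun setT (fun y => u (x + y)).
    by have := measurableT_comp mu (measurable_rV_translation x);
      under eq_fun do rewrite addrC.
  have mB : measurable B by exact: measurable_superlevel mux.
  have mA : measurable A.
    rewrite (_ : A = Q `\` B); first exact: measurableD.
    apply/seteqP; split=> y [Qy h]; split => //=.
      by apply/negP; rewrite -leNgt.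
    by rewrite leNgt; exact/negP.
  have BV : (leb B <= (V / 2)%:E)%E.
    rewrite (_ : B = (fun y => y + x) @^-1` [set y | t / 2 < `|u y|]); last first.
      by apply/seteqP; split=> y /=; rewrite addrC.
    rewrite lebesgue_rV_translation; last exact: measurable_superlevel.
    by apply: le_trans (HM _ t2) _; rewrite lee_fin /V mulrAC [2 * M]mulrC mulfK.
  have AV : ((V / 2)%:E <= leb A)%E.
    have : (leb Q <= leb A + leb B)%E.
      apply: (@le_trans _ _ (leb (A `|` B))); last exact: measureU2.
      apply: le_measure; rewrite ?inE//; first exact: measurableU.
      by move=> y Qy; have [h|h] := leP `|u (x + y)| (t / 2); [left|right].
    rewrite QV => QAB.
    have := le_trans QAB (leeD (lexx (leb A)) BV).
    by rewrite -leeBlDr// -EFinB {1}(splitr V) addrK.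
  rewrite (_ : t ^+ 2 * V / 8 = t ^+ 2 / 4 * (V / 2)); last by field.
  rewrite EFinM; apply: le_trans (_ : (t ^+ 2 / 4)%:E * leb A <= _)%E.
    by apply: lee_wpmul2l => //; rewrite lee_fin divr_ge0// exprn_ge0// ltW.
  apply: markov_set => //.
  - by rewrite divr_ge0// exprn_ge0// ltW.
  - exact: (measurableT_comp mH (pair1_measurable x)).
  move=> y [Qy /= uxy]; rewrite lee_fin indicE mem_set// mulr1.
  have h : t / 2 <= `|u (x + y) - u x|.
    by rewrite -normrN opprB (le_trans _ (lerB_dist _ _))//; lra.
  rewrite (_ : t ^+ 2 / 4 = (t / 2) ^+ 2); last by field.
  by rewrite -[leRHS]real_normK ?num_real// lerXn2r// nnegrE// ltW.
have c0 : 0 <= t ^+ 2 * V / 8 by rewrite divr_ge0// mulr_ge0 ?sqr_ge0// ltW.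
have L : ((t ^+ 2 * V / 8)%:E * leb [set x | (t < `|u x|)%R] <= (C * s ^+ 2 * V)%:E)%E.
  apply: le_trans Hle; apply: markov_set => //.
  - exact: measurable_superlevel.
  - exact: (measurable_fun_integral_snd leb mH).
  - by move=> x; exact: integral_ge0.
have c1 : 0 < t ^+ 2 * V / 8 by rewrite divr_gt0// mulr_gt0// exprn_gt0.
rewrite -lee_pdivlMl// in L; apply: le_trans L _; rewrite -EFinM lee_fin s2.
have -> : t `^ (- (2 + 2 * r / d%:R)) = t ^- 2 * t `^ (- (2 * r / d%:R)).
  rewrite opprD powRD; last by rewrite (gt_eqF t0) implybT.
  by rewrite powRN powR_mulrn// ltW.
set k := t `^ _; have k0 : 0 < k by exact: powR_gt0.
rewrite [leLHS](_ : _ = 8 * C * K * (t ^- 2 * k)); last by field; rewrite !gt_eqF.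
by rewrite ler_wpM2r ?lerDl// mulr_ge0 ?invr_ge0 ?sqr_ge0 ?ltW.
Qed.

End weak_type.

Section subcritical_exponents.
Context {R : realType} {d : nat}.
Local Notation leb := (lebesgue_rV R d).
Implicit Types (u : 'rV[R]_d -> R).

(** For [d > 2] the fixed point of this iteration is the critical exponent
    [2d/(d-2)], and the distance to it is multiplied by [2/d] at each step. *)
Fixpoint bootstrap_exponent (k : nat) : R :=
  if k is m.+1 then 2 + 2 * bootstrap_exponent m / d%:R else 2.

Lemma bootstrap_exponent_ge2 k : 2 <= bootstrap_exponent k.
Proof.
elim: k => [|k IH] //=; rewrite lerDl divr_ge0// mulr_ge0//.
by apply: le_trans IH.
Qed.

Lemma bootstrap_exponent_exceeds q : (0 < d)%N -> (q%:E < sobolev_exponent R d)%E ->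
  exists k, q < bootstrap_exponent k.
Proof.
move=> d0; have D0 : 0 < d%:R :> R by rewrite ltr0n.
rewrite /sobolev_exponent; case: leqP => [d2 _|d2].
- have H k : k%:R <= bootstrap_exponent k.
    elim: k => [//|k IH] /=.
    have h2 := bootstrap_exponent_ge2 k.
    have : bootstrap_exponent k <= 2 * bootstrap_exponent k / d%:R.
      rewrite ler_pdivlMr// mulrC ler_wpM2r//; first by apply: le_trans h2.
      by rewrite ler_nat.
    rewrite -natr1; lra.
  have [k qk] : exists k, q < k%:R.
    exists (Num.bound `|q|).
    exact: le_lt_trans (ler_norm q) (archi_boundP (normr_ge0 q)).
  by exists k; apply: lt_le_trans qk (H k).
- rewrite lte_fin => qs.
  have D2 : 0 < d%:R - 2 :> R by rewrite subr_gt0 ltr_nat.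
  set s := 2 * d%:R / (d%:R - 2) in qs.
  have sk k : bootstrap_exponent k = s - (2 / d%:R) ^+ k * (s - 2).
    elim: k => [|k IH] /=; first by rewrite expr0 mul1r; ring.
    by rewrite IH exprS /s; field; rewrite !gt_eqF.
  have s2 : 0 < s - 2.
    rewrite (_ : s - 2 = 4 / (d%:R - 2)); first by rewrite divr_gt0.
    by rewrite /s; field; rewrite gt_eqF.
  have c : (2 / d%:R) ^+ k @[k --> \oo] --> (0 : R).
    apply: cvg_expr; rewrite ger0_norm ?divr_ge0//.
    by rewrite ltr_pdivrMr// mul1r ltr_nat.
  have e0 : 0 < (s - q) / (s - 2) by rewrite divr_gt0// subr_gt0.
  have /cvgrPdist_lt/(_ _ e0)[k _ /(_ k (leqnn k))] := c.
  rewrite /= sub0r normrN => h; exists k; rewrite sk ltrBrDl addrC -ltrBrDl.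
  rewrite -ltr_pdivlMr//; apply: le_lt_trans h; exact: ler_norm.
Qed.

Lemma weak_type_bootstrap u C k : (0 < d)%N -> sqint u -> translation_bound u C ->
  weak_type u (bootstrap_exponent k).
Proof.
move=> d0 su uC; elim: k => [|k IH]; first exact: weak_type2.
apply: weak_type_step (uC) IH => //; last exact: su.1.
by apply: lt_le_trans (bootstrap_exponent_ge2 k).
Qed.

(** If [|a| > 1], the term of the series with [2^k < |a| <= 2^(k+1)] is enough. *)
Lemma dyadic_majorant (a q : R) : 2 <= q ->
  ((`|a| `^ q)%:E <= (a ^+ 2)%:E +
    \sum_(0 <= k <oo) (((2 ^+ k.+1) `^ q) * ((2 ^+ k < `|a|)%R : bool)%:R)%:E)%E.
Proof.
move=> q2.
have t0 k : (0 <= (((2 ^+ k.+1) `^ q) * ((2 ^+ k < `|a|)%R : bool)%:R)%:E)%E.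
  by rewrite lee_fin mulr_ge0// powR_ge0.
have [a1|a1] := leP `|a| 1.
  apply: (@le_trans _ _ (a ^+ 2)%:E); last by rewrite leeDl// nneseries_ge0.
  rewrite lee_fin -real_normK ?num_real// -powR_mulrn//.
  have [->|a0] := eqVneq a 0; first by rewrite normr0 !powR0// gt_eqF//; lra.
  by rewrite ger_powR// normr_gt0 a0.
have [n0 Hn0] : exists n, `|a| <= 2 ^+ n.+1.
  exists (Num.bound `|a|); apply: le_trans (ltW (archi_boundP (normr_ge0 a))) _.
  by rewrite -natrX ler_nat ltnW// ltnW// ltn_expl.
have [n Hn nmin] := ex_minnP (ex_intro (fun n => `|a| <= 2 ^+ n.+1) n0 Hn0).
have n2 : 2 ^+ n < `|a|.
  case: n nmin {Hn} => [_|n nmin]; first by rewrite expr0.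
  by rewrite ltNge; apply/negP => /nmin; rewrite ltnn.
apply: (@le_trans _ _ (((2 ^+ n.+1) `^ q) * ((2 ^+ n < `|a|)%R : bool)%:R)%:E).
  by rewrite n2 mulr1 lee_fin ge0_ler_powR// ?nnegrE//; lra.
rewrite (nneseriesD1 (n := n))// addeCA leeDl// adde_ge0 ?lee_fin ?sqr_ge0//.
exact: nneseries_ge0.
Qed.

(** Integrate the dyadic majorant: the series becomes geometric with ratio
    [2^(q-r) < 1]. *)
Lemma weak_type_powR_integral u q r : 2 <= q -> q < r -> sqint u -> weak_type u r ->
  (\int[leb]_x (`|u x| `^ q)%:E < +oo)%E.
Proof.
move=> q2 qr [mu u2] [M M0 HM].
have mu2 : measurable_fun setT (fun x => ((u x) ^+ 2)%:E).
  by apply/measurable_EFinP; exact: measurable_funX.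
pose f k x := (((2 ^+ k.+1) `^ q) * ((2 ^+ k < `|u x|)%R : bool)%:R)%:E.
have fE k : f k = (fun x => ((2 ^+ k.+1) `^ q)%:E *
  (\1_[set x | 2 ^+ k < `|u x|] x)%:E)%E.
  apply/funext => x; rewrite /f EFinM indicE; congr (_ * _%:E)%E.
  by congr (nat_of_bool _)%:R; apply/idP/idP; rewrite inE.
have mE k : measurable [set x | 2 ^+ k < `|u x|] by exact: measurable_superlevel.
have mf k : measurable_fun setT (f k).
  by rewrite fE; apply: measurable_funeM; apply/measurable_EFinP;
    exact: measurable_indic.
have f0 k x : (0 <= f k x)%E by rewrite lee_fin mulr_ge0// powR_ge0.
have If k : (\int[leb]_x f k x <= (2 `^ q * M * (2 `^ (q - r)) ^+ k)%:E)%E.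
  rewrite fE ge0_integralZl//; last first.
    by apply/measurable_EFinP; exact: measurable_indic.
  rewrite integral_indic// setIT.
  apply: le_trans (lee_wpmul2l _ (HM (2 ^+ k) _)) _ => //.
  rewrite -EFinM lee_fin le_eqVlt; apply/orP; left; apply/eqP.
  have pX (a : R) : (2 ^+ k) `^ a = (2 `^ a) ^+ k.
    by rewrite -!powR_mulrn ?powR_ge0// powRAC.
  have -> : 2 `^ (q - r) = 2 `^ q * 2 `^ (- r) :> R.
    by rewrite powRD// pnatr_eq0 implybT.
  by rewrite exprS powRM ?exprn_ge0// !pX exprMn; ring.
have sf : (\int[leb]_x \sum_(0 <= k <oo) f k x < +oo)%E.
  rewrite integral_nneseries//.
  apply: (@le_lt_trans _ _ 
    (\sum_(0 <= k <oo) (geometric (2 `^ q * M) (2 `^ (q - r)) k)%:E)%E).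
    apply: lee_nneseries => [k _ _|k _]; first exact: integral_ge0.
    exact: If.
  have g1 : `|2 `^ (q - r)| < 1 :> R.
    rewrite ger0_norm ?powR_ge0// -opprB powRN invf_lt1 ?powR_gt0//.
    have rq : 0 < r - q by rewrite subr_gt0.
    have := gt0_ltr_powR rq (_ : 1 \in Num.nneg) (_ : 2 \in Num.nneg).
    by rewrite powR1; apply; rewrite ?nnegrE// ltr1n.
  have cg := cvg_geometric_series (a := 2 `^ q * M) g1.
  rewrite (_ : limn _ = (2 `^ q * M * (1 - 2 `^ (q - r))^-1)%:E) ?ltry//.
  apply/cvg_lim => //; apply: cvg_EFin.
    by apply: nearW => n; rewrite sumEFin.
  rewrite [X in X @ _ --> _](_ : _ = series (geometric (2 `^ q * M) (2 `^ (q - r))))//.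
  by apply/funext => n; rewrite /= sumEFin.
apply: (@le_lt_trans _ _ (\int[leb]_x (((u x) ^+ 2)%:E + \sum_(0 <= k <oo) f k x))%E).
  apply: ge0_le_integral => //.
  - apply/measurable_EFinP; apply: (measurableT_comp (measurable_powR _)).
    exact: measurableT_comp.
  - apply: emeasurable_funD => //; apply: ge0_emeasurable_sum => //.
  - by move=> x _; exact: dyadic_majorant.
rewrite ge0_integralD//.
- exact: lte_add_pinfty.
- by move=> x _; rewrite lee_fin sqr_ge0.
- by move=> x _; exact: nneseries_ge0.
- exact: ge0_emeasurable_sum.
Qed.
End subcritical_exponents.

(** * Classes of complex-valued functions *)

Section continuous_measurable.
Context {R : realType} {d : nat}.

Lemma rational_box (x : 'rV[R]_d) (U : set 'rV[R]_d) : nbhs x U ->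
  exists a b : {ffun 'I_d -> rat},
    obox (fun i => ratr (a i)) (fun i => ratr (b i)) x /\
    obox (fun i => ratr (a i)) (fun i => ratr (b i)) `<=` U.
Proof.
move=> /nbhs_ballP[r /= r0 rU].
have /choice[a Ha] : forall i, exists q : rat, x ord0 i - r < ratr q < x ord0 i.
  move=> i; have xr : x ord0 i - r < x ord0 i by rewrite ltrBlDr ltrDl.
  by have [q qx] := rat_in_itvoo xr; exists q; move: qx; rewrite in_itv.
have /choice[b Hb] : forall i, exists q : rat, x ord0 i < ratr q < x ord0 i + r.
  move=> i; have xr : x ord0 i < x ord0 i + r by rewrite ltrDl.
  by have [q qx] := rat_in_itvoo xr; exists q; move: qx; rewrite in_itv.
exists [ffun i => a i], [ffun i => b i]; split.
  by move=> i; rewrite !ffunE; have /andP[_ ->] := Ha i; have /andP[->] := Hb i.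
move=> y yab; apply: rU; split => // i0 j; rewrite ord1 /ball /=.
have := yab j; rewrite !ffunE => /andP[h1 h2].
have /andP[h3 _] := Ha j; have /andP[_ h4] := Hb j.
by rewrite ltr_distlC; apply/andP; split; lra.
Qed.

(** Open sets are countable unions of boxes with rational vertices. *)
Lemma rV_open_measurable (U : set 'rV[R]_d) : open U -> measurable U.
Proof.
move=> oU.
pose F (ab : {ffun 'I_d -> rat} * {ffun 'I_d -> rat}) : set 'rV[R]_d :=
  let B := obox (fun i => ratr (ab.1 i) : R) (fun i => ratr (ab.2 i)) in
  if `[< B `<=` U >] then B else set0.
have -> : U = \bigcup_ab F ab.
  apply/seteqP; split => [x Ux|x [ab _]]; last first.
    by rewrite /F; case: ifPn => // /asboolP; apply.
  have [a [b [xab abU]]] := rational_box (open_nbhs_nbhs (conj oU Ux)).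
  by exists (a, b) => //; rewrite /F /= ifT//; exact/asboolP.
apply: countable_bigcupT_measurable; first exact: countableP.
by move=> ab; rewrite /F; case: ifPn => _; [exact: measurable_obox|exact: measurable0].
Qed.

Lemma rV_continuous_measurable (f : 'rV[R]_d -> R) :
  continuous f -> measurable_fun setT f.
Proof.
move=> /continuousP cf; apply: (measurability _ (RGenOInfty.measurableE R)) => //.
move=> /= _ [_ [a ->] <-]; rewrite setTI; apply: rV_open_measurable; apply: cf.
exact: interval_open.
Qed.
End continuous_measurable.

Section complex_measurability.
Context {R : realType}.
Local Notation C := R[i].

Lemma measurable_Re : measurable_fun [set: C] (@complex.Re R).
Proof.
by move=> _ Y mY; rewrite setTI; apply: sub_sigma_algebra; left; exists Y => //;
  rewrite setTI.
Qed.

Lemma measurable_Im : measurable_fun [set: C] (@complex.Im R).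
Proof.
by move=> _ Y mY; rewrite setTI; apply: sub_sigma_algebra; right; exists Y => //;
  rewrite setTI.
Qed.

Lemma measurable_fun_complex dd (T : measurableType dd) (f : T -> C) :
  measurable_fun setT (fun x => complex.Re (f x)) ->
  measurable_fun setT (fun x => complex.Im (f x)) -> measurable_fun setT f.
Proof.
move=> mr mi _ A mA; rewrite setTI.
suff: g_sigma_preimageU (@complex.Re R) (@complex.Im R) `<=`
    [set B | measurable (f @^-1` B)] by apply.
apply: smallest_sub.
  split=> /=; first by rewrite preimage_set0.
  - by move=> B mB; rewrite setTD preimage_setC; exact: measurableC.
  - by move=> F mF; rewrite preimage_bigcup; exact: bigcup_measurable.
by move=> _ [|] [B mB <-] /=; rewrite setTI -[X in measurable X]setTI -comp_preimage;
  [exact: mr|exact: mi].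
Qed.

Lemma normc_sqr (z : C) : normc z ^+ 2 = complex.Re z ^+ 2 + complex.Im z ^+ 2.
Proof. by case: z => a b; rewrite /normc sqr_sqrtr// addr_ge0 ?sqr_ge0. Qed.

Lemma normc_ge0 (z : C) : 0 <= normc z.
Proof. by case: z => a b; exact: sqrtr_ge0. Qed.

Lemma normc_sqrt (z : C) : normc z = Num.sqrt (complex.Re z ^+ 2 + complex.Im z ^+ 2).
Proof. by case: z. Qed.

Lemma measurable_sqrt : measurable_fun [set: R] (@Num.sqrt R).
Proof. by apply: continuous_measurable_fun; exact: sqrt_continuous. Qed.

Lemma measurable_normc dd (T : measurableType dd) (f : T -> C) :
  measurable_fun setT f -> measurable_fun setT (fun x => normc (f x)).
Proof.
move=> mf; under eq_fun do rewrite normc_sqrt.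
apply: (measurableT_comp measurable_sqrt); apply: measurable_funD;
  apply: measurable_funX.
- exact: (measurableT_comp measurable_Re mf).
- exact: (measurableT_comp measurable_Im mf).
Qed.

Lemma measurable_normc_powR dd (T : measurableType dd) (f : T -> C) (q : R) :
  measurable_fun setT f -> measurable_fun setT (fun x => (normc (f x) `^ q)%:E).
Proof.
move=> mf; apply/measurable_EFinP; apply: (measurableT_comp (measurable_powR _)).
exact: measurable_normc.
Qed.

Lemma measurable_complexB dd (T : measurableType dd) (f g : T -> C) :
  measurable_fun setT f -> measurable_fun setT g ->
  measurable_fun setT (fun x => f x - g x).
Proof.
move=> mf mg.
have mre := measurable_funB (measurableT_comp measurable_Re mf)
                            (measurableT_comp measurable_Re mg).
have mim := measurable_funB (measurableT_comp measurable_Im mf)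
                            (measurableT_comp measurable_Im mg).
apply: measurable_fun_complex.
- by apply: eq_measurable_fun mre => x _ /=; case: (f x) => a b; case: (g x).
- by apply: eq_measurable_fun mim => x _ /=; case: (f x) => a b; case: (g x).
Qed.

Lemma Re_mul_real (z : C) (t : R) : complex.Re (z * t%:C%C) = complex.Re z * t.
Proof. by case: z => a b /=; rewrite mulr0 subr0. Qed.

Lemma Im_mul_real (z : C) (t : R) : complex.Im (z * t%:C%C) = complex.Im z * t.
Proof. by case: z => a b /=; rewrite mulr0 add0r. Qed.

Lemma normc_real_mul (t : R) (z : C) : normc (t%:C%C * z) = `|t| * normc z.
Proof. by rewrite normcM /normc /= expr0n /= addr0 sqrtr_sqr. Qed.

End complex_measurability.

Section classes.
Context {R : realType} {d : nat}.
Local Notation leb := (lebesgue_rV R d).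
Local Notation Rd := 'rV[R]_d.

Lemma measurable_cfun (f : cfun R d) : measurable_fun [set: Rd] (f : Rd -> R[i]).
Proof. exact: (@measurable_funPT _ _ _ _ (repr f)). Qed.

Definition class_of (F : Rd -> R[i]) (mF : measurable_fun [set: Rd] F) : cfun R d :=
  (\pi_(cfun R d)
    (HB.pack F (isMeasurableFun.Build _ _ _ _ F mF) : {mfun Rd >-> R[i]}))%qT.

Lemma class_ofE F mF : {ae leb, forall x, @class_of F mF x = F x}.
Proof.
set Fm : {mfun Rd >-> R[i]} := HB.pack F (isMeasurableFun.Build _ _ _ _ F mF).
have : (repr (@class_of F mF) == Fm %[mod (cfun R d)])%qT by rewrite reprK.
by rewrite eqmodE => /asboolP; apply: filterS => x /(_ I).
Qed.

Lemma cfun_eq (f g : cfun R d) : {ae leb, forall x, f x = g x} -> f = g.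
Proof.
move=> fg; rewrite -[f]reprK -[g]reprK; apply/eqP; rewrite eqmodE.
by apply/asboolP; apply: filterS fg => x.
Qed.

End classes.

(** * The Sobolev embedding and the uniqueness of weak gradients *)

Section sobolev_embedding.
Context {R : realType} {d : nat}.
Local Notation leb := (lebesgue_rV R d).
Local Notation Rd := 'rV[R]_d.
Implicit Types (F G : Rd -> R[i]) (q t : R).

Lemma cLnormE q F :
  cLnorm q F = ((\int[leb]_x (normc (F x) `^ q)%:E) `^ q^-1)%E.
Proof.
rewrite /cLnorm unlock; congr (_ `^ _)%E; apply: eq_integral => x _.
by rewrite poweR_EFin ger0_norm ?normc_ge0.
Qed.

Lemma cLnorm_ltyP q F : 0 < q ->
  (cLnorm q F < +oo)%E <-> (\int[leb]_x (normc (F x) `^ q)%:E < +oo)%E.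
Proof.
move=> q0; split => [h|h]; last by rewrite cLnormE poweR_lty.
have -> : (\int[leb]_x (normc (F x) `^ q)%:E = cLnorm q F `^ q)%E.
  rewrite cLnormE -poweRrM mulVf ?gt_eqF// poweRe1//.
  by apply: integral_ge0 => x _; rewrite lee_fin powR_ge0.
exact: poweR_lty.
Qed.

Lemma eq_ae_cLnorm q F G : measurable_fun setT F -> measurable_fun setT G ->
  {ae leb, forall x, F x = G x} -> cLnorm q F = cLnorm q G.
Proof.
move=> mF mG FG; rewrite !cLnormE; congr (_ `^ _)%E; apply: ae_eq_integral => //.
- exact: measurable_normc_powR.
- exact: measurable_normc_powR.
- by apply: filterS FG => x ->.
Qed.

Lemma cLnormZ q t F : 0 < q -> measurable_fun setT F ->
  cLnorm q (fun x => t%:C%C * F x) = (`|t|%:E * cLnorm q F)%E.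
Proof.
move=> q0 mF; rewrite !cLnormE.
under eq_integral do rewrite normc_real_mul powRM ?normc_ge0// EFinM.
rewrite ge0_integralZl//.
- rewrite poweRM ?lee_fin ?powR_ge0//.
    by rewrite poweR_EFin -powRrM mulfV ?gt_eqF// powRr1.
  by apply: integral_ge0 => x _; rewrite lee_fin powR_ge0.
- exact: measurable_normc_powR.
- by move=> x _; rewrite lee_fin powR_ge0.
Qed.

Lemma cLnorm2_sqint F : measurable_fun setT F -> (cLnorm 2 F < +oo)%E ->
  sqint (fun x => complex.Re (F x)) /\ sqint (fun x => complex.Im (F x)).
Proof.
move=> mF /(cLnorm_ltyP F (ltr0Sn R 1)) F2.
have mre := measurableT_comp measurable_Re mF.
have mim := measurableT_comp measurable_Im mF.
have mn : measurable_fun setT (fun x => (normc (F x) `^ 2)%:E).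
  exact: measurable_normc_powR.
split; (split => //; apply: le_lt_trans F2; apply: ge0_le_integral => //;
  [by move=> x _; rewrite lee_fin sqr_ge0
  |by apply/measurable_EFinP; exact: measurable_funX
  |move=> x _; rewrite lee_fin powR_mulrn ?normc_ge0// normc_sqr]).
- by rewrite lerDl sqr_ge0.
- by rewrite lerDr sqr_ge0.
Qed.

Lemma weak_partial_ReIm i F G : weak_partial i F G ->
  weak_deriv i (fun x => complex.Re (F x)) (fun x => complex.Re (G x)) /\
  weak_deriv i (fun x => complex.Im (F x)) (fun x => complex.Im (G x)).
Proof.
move=> FG; split => phi tphi; have E := FG phi tphi.
- have Re_E : \int[leb]_x complex.Re (F x * (partial i phi x)%:C%C) =
      - \int[leb]_x complex.Re (G x * (phi x)%:C%C) := congr1 (@complex.Re R) E.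
  under eq_Rintegral do rewrite -Re_mul_real; rewrite Re_E.
  by under eq_Rintegral do rewrite Re_mul_real.
- have Im_E : \int[leb]_x complex.Im (F x * (partial i phi x)%:C%C) =
      - \int[leb]_x complex.Im (G x * (phi x)%:C%C) := congr1 (@complex.Im R) E.
  under eq_Rintegral do rewrite -Im_mul_real; rewrite Im_E.
  by under eq_Rintegral do rewrite Im_mul_real.
Qed.

(** The real and the imaginary part of [f] separately satisfy the weak-type bounds. *)
Lemma H1_Lq (f : cfun R d) q : (0 < d)%N -> H1 f -> 2 < q ->
  (q%:E < sobolev_exponent R d)%E -> (cLnorm q f < +oo)%E.
Proof.
move=> d0 [f2 [g fg]] q2 qs; have q0 : 0 < q by apply: lt_trans q2.
have [k qk] := bootstrap_exponent_exceeds d0 qs.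
have mf := measurable_cfun f.
have [sre sim] := cLnorm2_sqint mf f2.
have sg i := cLnorm2_sqint (measurable_cfun (g i)) (fg i).1.
have wg i := weak_partial_ReIm (fg i).2.
have [C1 tb1] := weak_deriv_translation_bound sre
  (fun i => (sg i).1) (fun i => (wg i).1).
have [C2 tb2] := weak_deriv_translation_bound sim
  (fun i => (sg i).2) (fun i => (wg i).2).
have I1 := weak_type_powR_integral (ltW q2) qk sre (weak_type_bootstrap k d0 sre tb1).
have I2 := weak_type_powR_integral (ltW q2) qk sim (weak_type_bootstrap k d0 sim tb2).
have mpow (u : Rd -> R) : measurable_fun setT u ->
    measurable_fun setT (fun x => (`|u x| `^ q)%:E).
  move=> mu; apply/measurable_EFinP; apply: (measurableT_comp (measurable_powR _)).
  exact: measurableT_comp.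
have m1 := mpow _ sre.1; have m2 := mpow _ sim.1.
apply/(cLnorm_ltyP f q0).
apply: (@le_lt_trans _ _ 
  (\int[leb]_x ((2 `^ q)%:E *
    ((`|complex.Re (f x)| `^ q)%:E + (`|complex.Im (f x)| `^ q)%:E)))%E).
  apply: ge0_le_integral => //.
  - by move=> x _; rewrite lee_fin powR_ge0.
  - exact: measurable_normc_powR.
  - by apply: measurable_funeM; exact: emeasurable_funD.
  move=> x _; rewrite -EFinD -EFinM lee_fin.
  set a := `|complex.Re (f x)|; set b := `|complex.Im (f x)|.
  have m0 : 0 <= Num.max a b by rewrite le_max normr_ge0.
  have nab : normc (f x) <= 2 * Num.max a b.
    rewrite -ler_sqr ?nnegrE ?normc_ge0 ?mulr_ge0// normc_sqr.
    rewrite -(real_normK (num_real (complex.Re _))) -/a.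
    rewrite -(real_normK (num_real (complex.Im _))) -/b.
    have am : a ^+ 2 <= Num.max a b ^+ 2.
      by rewrite lerXn2r ?nnegrE ?le_max ?lexx// normr_ge0.
    have bm : b ^+ 2 <= Num.max a b ^+ 2.
      by rewrite lerXn2r ?nnegrE ?le_max ?lexx ?orbT// normr_ge0.
    by rewrite exprMn; nra.
  apply: (@le_trans _ _ ((2 * Num.max a b) `^ q)).
    by apply: ge0_ler_powR; rewrite ?nnegrE ?normc_ge0 ?(ltW q0) ?mulr_ge0.
  rewrite powRM// ler_wpM2l ?powR_ge0//.
  by case: (leP a b) => _; rewrite ?lerDr ?lerDl powR_ge0.
rewrite ge0_integralZl//; last 2 first.
- exact: emeasurable_funD.
- by move=> x _; rewrite adde_ge0// lee_fin powR_ge0.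
rewrite lte_mul_pinfty ?lee_fin ?powR_ge0// ge0_integralD//.
exact: lte_add_pinfty.
Qed.

Lemma weak_grad_unique (f : cfun R d) g g' : weak_grad f g -> weak_grad f g' ->
  forall i, g i = g' i.
Proof.
move=> fg fg' i.
have [sre sim] := cLnorm2_sqint (measurable_cfun (g i)) (fg i).1.
have [sre' sim'] := cLnorm2_sqint (measurable_cfun (g' i)) (fg' i).1.
have [wre wim] := weak_partial_ReIm (fg i).2.
have [wre' wim'] := weak_partial_ReIm (fg' i).2.
have key (u v v' : Rd -> R) : sqint v -> sqint v' ->
    weak_deriv i u v -> weak_deriv i u v' ->
    {ae leb, forall x, v x - v' x = 0}.
  move=> sv sv' uv uv'; apply: fundamental_lemma; first exact: sqintB.
  move=> phi a b tphi.
  have iv := integrable_mul_tensor sv tphi.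
  have iv' := integrable_mul_tensor sv' tphi.
  under eq_Rintegral do rewrite mulrBl.
  rewrite RintegralB//; apply/eqP; rewrite subr_eq0 -eqr_opp.
  have tf := test_function_tensor tphi.1 tphi.2.
  by rewrite -(uv _ tf) -(uv' _ tf).
have h1 := key _ _ _ sre sre' wre wre'; have h2 := key _ _ _ sim sim' wim wim'.
apply: cfun_eq; apply: filterS2 h1 h2 => x.
case: (g i x) => a b; case: (g' i x) => a' b' /= /eqP; rewrite subr_eq0 => /eqP ->.
by move=> /eqP; rewrite subr_eq0 => /eqP ->.
Qed.

End sobolev_embedding.

(** * Multiplication by a scalar *)

Section scaling.
Context {R : realType} {d : nat}.
Local Notation leb := (lebesgue_rV R d).
Local Notation Rd := 'rV[R]_d.
Implicit Types (f : cfun R d) (t q : R).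

Lemma measurable_fun_scale t (F : Rd -> R[i]) : measurable_fun setT F ->
  measurable_fun [set: Rd] (fun x => t%:C%C * F x).
Proof.
move=> mF; under eq_fun do rewrite mulrC.
have mre := measurable_funM (measurableT_comp measurable_Re mF)
  (measurable_cst (t : R)).
have mim := measurable_funM (measurableT_comp measurable_Im mF)
  (measurable_cst (t : R)).
apply: measurable_fun_complex.
- by apply: eq_measurable_fun mre => x _; rewrite Re_mul_real.
- by apply: eq_measurable_fun mim => x _; rewrite Im_mul_real.
Qed.

Definition scale t f : cfun R d :=
  class_of (measurable_fun_scale t (measurable_cfun f)).

Lemma scaleE t f : {ae leb, forall x, scale t f x = t%:C%C * f x}.
Proof. exact: class_ofE. Qed.

Lemma cfun0E : {ae leb, forall x, (cfun0 : cfun R d) x = 0}.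
Proof.
have : (repr (cfun0 : cfun R d) == cst 0 %[mod (cfun R d)])%qT by rewrite reprK.
by rewrite eqmodE => /asboolP; apply: filterS => x /(_ I).
Qed.

Lemma scale1 f : scale 1 f = f.
Proof. by apply: cfun_eq; apply: filterS (scaleE 1 f) => x ->; rewrite mul1r. Qed.

Lemma scale0 f : scale 0 f = cfun0.
Proof.
by apply: cfun_eq; apply: filterS2 (scaleE 0 f) cfun0E => x -> ->; rewrite mul0r.
Qed.

Lemma scale_cfun0 t : scale t cfun0 = cfun0.
Proof.
by apply: cfun_eq; apply: filterS2 (scaleE t cfun0) cfun0E => x -> ->; rewrite mulr0.
Qed.

Lemma scale_neq0 t f : 0 < t -> f <> cfun0 -> scale t f <> cfun0.
Proof.
move=> t0 f0 tf0; apply: f0; apply: cfun_eq.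
have E := scaleE t f; rewrite tf0 in E.
apply: filterS2 E cfun0E => x E0 E1; rewrite E1; move: E0; rewrite E1 => /esym/eqP.
rewrite mulf_eq0 => /orP[/eqP tC|/eqP //].
by have := congr1 (@complex.Re R) tC; move/eqP; rewrite /= gt_eqF.
Qed.

Lemma cLnorm_scale q t f : 0 < q -> cLnorm q (scale t f) = (`|t|%:E * cLnorm q f)%E.
Proof.
move=> q0; rewrite -(cLnormZ t q0 (measurable_cfun f)).
apply: eq_ae_cLnorm; last exact: scaleE.
- exact: measurable_cfun.
- exact: measurable_fun_scale (measurable_cfun f).
Qed.

Lemma cLnorm_scaleB q s t f : 0 < q ->
  cLnorm q (fun x => scale s f x - scale t f x) = (`|s - t|%:E * cLnorm q f)%E.
Proof.
move=> q0; rewrite -(cLnormZ (s - t) q0 (measurable_cfun f)).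
apply: eq_ae_cLnorm.
- by apply: measurable_complexB; exact: measurable_cfun.
- exact: measurable_fun_scale (measurable_cfun f).
- by apply: filterS2 (scaleE s f) (scaleE t f) => x -> ->; rewrite -mulrBl -raddfB.
Qed.

Lemma fine_mul_ge0 (a : R) (x : \bar R) : 0 <= a -> fine (a%:E * x)%E = a * fine x.
Proof.
rewrite le_eqVlt => /predU1P[<-|a0]; first by rewrite mul0e mul0r.
by case: x => [r||]; rewrite ?gt0_muley ?gt0_muleNy ?lte_fin ?mulr0.
Qed.

Lemma normL_scale q t f : 0 < q -> normL q (scale t f) = `|t| * normL q f.
Proof. by move=> q0; rewrite /normL cLnorm_scale// fine_mul_ge0. Qed.

(** A positive factor can be moved out of the integral even where that integral is
    [+oo - oo], whose conventional value is positively homogeneous. *)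
Lemma RintegralZl_gt0 (t : R) (h : Rd -> R) : 0 < t -> measurable_fun setT h ->
  \int[leb]_x (t * h x) = t * \int[leb]_x h x.
Proof.
move=> t0 mh; rewrite /Rintegral -fine_mul_ge0 ?ltW//; congr fine.
have mhE : measurable_fun setT (EFin \o h) by exact/measurable_EFinP.
rewrite integralE [in RHS]integralE.
have P0 : (0 <= \int[leb]_x (EFin \o h)^\+ x)%E by apply: integral_ge0.
have N0 : (0 <= \int[leb]_x (EFin \o h)^\- x)%E by apply: integral_ge0.
have -> : (\int[leb]_x (fun x => (t * h x)%:E)^\+ x =
    t%:E * \int[leb]_x (EFin \o h)^\+ x)%E.
  rewrite -ge0_integralZl//; last 2 first.
  - exact: measurable_funepos.
  - by rewrite lee_fin ltW.
  apply: eq_integral => x _.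
  by rewrite -[RHS]/((fun x => t%:E * _)%E x) -(ge0_funeposM (EFin \o h) (ltW t0)).
have -> : (\int[leb]_x (fun x => (t * h x)%:E)^\- x =
    t%:E * \int[leb]_x (EFin \o h)^\- x)%E.
  rewrite -ge0_integralZl//; last 2 first.
  - exact: measurable_funeneg.
  - by rewrite lee_fin ltW.
  apply: eq_integral => x _.
  by rewrite -[RHS]/((fun x => t%:E * _)%E x) -(ge0_funenegM (EFin \o h) (ltW t0)).
move: P0 N0; case: (\int[leb]_x (EFin \o h)^\+ x)%E => [a||] // P0;
  case: (\int[leb]_x (EFin \o h)^\- x)%E => [b||] // N0;
  rewrite ?gt0_muley ?lte_fin //=; rewrite ?gt0_muley ?gt0_muleNy ?lte_fin//.
by rewrite -!EFinM -EFinB; congr EFin; ring.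
Qed.

End scaling.

Section scaling_H1.
Context {R : realType} {d : nat}.
Local Notation leb := (lebesgue_rV R d).
Local Notation Rd := 'rV[R]_d.
Implicit Types (f : cfun R d) (t q : R).

Lemma eq_ae_Rintegral (u v : Rd -> R) :
  measurable_fun setT u -> measurable_fun setT v ->
  {ae leb, forall x, u x = v x} -> \int[leb]_x u x = \int[leb]_x v x.
Proof.
move=> mu mv uv; congr fine; apply: ae_eq_integral => //; try exact/measurable_EFinP.
by apply: filterS uv => x ->.
Qed.

Lemma cintegral_scale t f (phi : Rd -> R) : 0 < t -> measurable_fun setT phi ->
  cintegral (fun x => scale t f x * (phi x)%:C%C) =
  t%:C%C * cintegral (fun x => f x * (phi x)%:C%C).
Proof.
move=> t0 mphi.
have mre (g : cfun R d) := measurableT_comp measurable_Re (measurable_cfun g).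
have mim (g : cfun R d) := measurableT_comp measurable_Im (measurable_cfun g).
have E1 : \int[leb]_x complex.Re (scale t f x * (phi x)%:C%C) =
    t * \int[leb]_x complex.Re (f x * (phi x)%:C%C).
  under eq_Rintegral do rewrite Re_mul_real;
    under [in RHS]eq_Rintegral do rewrite Re_mul_real.
  rewrite -RintegralZl_gt0//; last exact: measurable_funM (mre f) mphi.
  apply: eq_ae_Rintegral.
  - exact: measurable_funM (mre _) mphi.
  - by apply: measurable_funM => //; exact: measurable_funM (mre f) mphi.
  - by apply: filterS (scaleE t f) => x ->;
    rewrite [t%:C%C * _]mulrC Re_mul_real [_ * t]mulrC mulrA.
have E2 : \int[leb]_x complex.Im (scale t f x * (phi x)%:C%C) =
    t * \int[leb]_x complex.Im (f x * (phi x)%:C%C).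
  under eq_Rintegral do rewrite Im_mul_real;
    under [in RHS]eq_Rintegral do rewrite Im_mul_real.
  rewrite -RintegralZl_gt0//; last exact: measurable_funM (mim f) mphi.
  apply: eq_ae_Rintegral.
  - exact: measurable_funM (mim _) mphi.
  - by apply: measurable_funM => //; exact: measurable_funM (mim f) mphi.
  - by apply: filterS (scaleE t f) => x ->;
    rewrite [t%:C%C * _]mulrC Im_mul_real [_ * t]mulrC mulrA.
by rewrite /cintegral E1 E2; apply/eqP; rewrite eq_complex /= !mul0r subr0 addr0 !eqxx.
Qed.

Lemma weak_grad_scale t f g : 0 < t -> weak_grad f g ->
  weak_grad (scale t f) (fun i => scale t (g i)).
Proof.
move=> t0 fg i; have [gi wi] := fg i; split.
  by rewrite cLnorm_scale// lte_mul_pinfty// lee_fin.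
move=> phi tphi; have [sphi _] := tphi.
have m0 : measurable_fun setT phi := rV_continuous_measurable (sphi [::]).1.
have m1 : measurable_fun setT (partial i phi) :=
  rV_continuous_measurable (sphi [:: i]).1.
by rewrite !cintegral_scale// wi// mulrN.
Qed.

Lemma gradP f : H1 f -> weak_grad f (grad f).
Proof.
move=> [_ [g fg]].
exact: (@xgetPex _ (fun=> cfun0) (weak_grad f) (ex_intro _ g fg)).
Qed.

Lemma H1_scale t f : 0 < t -> H1 f -> H1 (scale t f).
Proof.
move=> t0 [f2 [g fg]]; split; first by rewrite cLnorm_scale// lte_mul_pinfty// lee_fin.
by exists (fun i => scale t (g i)); exact: weak_grad_scale.
Qed.

Lemma grad_scale t f i : 0 < t -> H1 f -> grad (scale t f) i = scale t (grad f i).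
Proof.
move=> t0 Hf.
exact: (weak_grad_unique (gradP (H1_scale t0 Hf)) (weak_grad_scale t0 (gradP Hf)) i).
Qed.

(** The norm of the gradient is put in the form of the norm of a complex function, to
    which the homogeneity [cLnormZ] applies. *)
Lemma normgradE f : normgrad f =
  fine (cLnorm 2 (fun x =>
    (Num.sqrt (\sum_(i < d) normc (grad f i x) ^+ 2)%R)%:C%C : R[i])).
Proof.
congr fine; apply: eq_Lnorm => x.
by rewrite /normc /= expr0n /= addr0 sqrtr_sqr ger0_norm ?sqrtr_ge0.
Qed.

Lemma normgrad_scale t f : 0 < t -> H1 f -> normgrad (scale t f) = t * normgrad f.
Proof.
move=> t0 Hf; rewrite !normgradE -fine_mul_ge0 ?ltW//.
pose G (g : cfun R d) x : R := Num.sqrt (\sum_(i < d) normc (grad g i x) ^+ 2).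
have mG g : measurable_fun setT (G g).
  apply: (measurableT_comp measurable_sqrt); apply: measurable_sum => i.
  by apply: measurable_funX; apply: measurable_normc; exact: measurable_cfun.
have mGC g : measurable_fun setT (fun x => (G g x)%:C%C).
  by apply: measurable_fun_complex => //=; exact: measurable_cst.
rewrite -{2}(ger0_norm (ltW t0)) -(cLnormZ t (ltr0Sn R 1) (mGC f)).
congr fine; apply: eq_ae_cLnorm;
  [exact: (mGC (scale t f))|exact: (measurable_fun_scale t (mGC f))|].
have ae_all : {ae leb, forall x, forall i : 'I_d,
    grad (scale t f) i x = t%:C%C * grad f i x}.
  apply: filter_forall => i; rewrite grad_scale//; exact: scaleE.
apply: filterS ae_all => x H; rewrite -rmorphM; congr (_%:C%C).
rewrite /G (eq_bigr (fun i => t ^+ 2 * normc (grad f i x) ^+ 2)); last first.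
  by move=> i _; rewrite H normc_real_mul exprMn real_normK ?num_real.
by rewrite -mulr_sumr sqrtrM ?sqr_ge0// sqrtr_sqr gtr0_norm.
Qed.

End scaling_H1.

(** * Rays in the potential well *)

Section potential_well.
Context {R : realType} {d : nat}.
Implicit Types (f : cfun R d) (p q t : R).

(** Bernoulli's inequality for a real exponent, from Young's inequality
    [x * 1 <= x^s / s + 1 / s'] with [1/s + 1/s' = 1]. *)
Lemma powR_bernoulli (x s : R) : 0 <= x -> 1 < s -> 1 - x `^ s <= s * (1 - x).
Proof.
move=> x0 s1; have s0 : 0 < s by apply: lt_trans s1.
have s10 : 0 < s - 1 by rewrite subr_gt0.
have := @conjugate_powR R x 1 s (s / (s - 1)) x0 ler01 _ _ _.
rewrite powR1 mulr1 => /(_ s0 (divr_gt0 s0 s10)) H.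
have /H : s^-1 + (s / (s - 1))^-1 = 1 by field; rewrite !gt_eqF.
move=> K; have : s * x <= s * (x `^ s / s + 1 / (s / (s - 1))) by rewrite ler_pM2l.
rewrite (_ : s * (_ + _) = x `^ s + (s - 1)); first by lra.
by field; rewrite !gt_eqF.
Qed.

(** The left-hand side is [x A - x^s C] with [x = t^((p-1)/(s-1))], and
    [C (1 - x^s) <= s C (1 - x) <= A (1 - x)]. *)
Lemma energy_path_le (A C p s t : R) : 0 <= C -> s * C < A -> 1 < p -> 1 < s ->
  0 < t <= 1 ->
  t `^ ((p + 1 - 2 * s) / (s - 1)) * (t ^+ 2 * A - t `^ (p + 1) * C) <= A - C.
Proof.
move=> C0 sCA p1 s1 /andP[t0 t1].
have s10 : 0 < s - 1 by rewrite subr_gt0.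
have tD (a b : R) : t `^ (a + b) = t `^ a * t `^ b.
  by rewrite powRD// (gt_eqF t0) implybT.
pose x := t `^ ((p - 1) / (s - 1)).
have x0 : 0 < x by exact: powR_gt0.
have x1 : x <= 1.
  have e0 : 0 <= (p - 1) / (s - 1) by rewrite divr_ge0 ?subr_ge0 ?(ltW p1) ?(ltW s1).
  have := ge0_ler_powR e0 (_ : t \in Num.nneg) (_ : 1 \in Num.nneg) t1.
  by rewrite powR1; apply; rewrite nnegrE ?(ltW t0).
have E1 : t `^ ((p + 1 - 2 * s) / (s - 1)) * t ^+ 2 = x.
  rewrite -powR_mulrn ?(ltW t0)// -tD; congr (_ `^ _); by field; rewrite gt_eqF.
have E2 : t `^ ((p + 1 - 2 * s) / (s - 1)) * t `^ (p + 1) = x `^ s.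
  rewrite -tD -powRrM; congr (_ `^ _); by field; rewrite gt_eqF.
rewrite mulrBr [_ * (t ^+ 2 * A)]mulrA [_ * (_ `^ _ * C)]mulrA E1 E2.
have := powR_bernoulli (ltW x0) s1; set y := x `^ s => B.
have : C * (1 - y) <= C * (s * (1 - x)) by rewrite ler_wpM2l.
have : (s * C) * (1 - x) <= A * (1 - x) by rewrite ler_wpM2r ?subr_ge0// ltW.
nra.
Qed.

Lemma infN2_ge0 p : 0 <= infN2 d p.
Proof.
rewrite /infN2; set S := [set _ | _ in _].
have S0 x : S x -> 0 <= x by move=> [f _ <-]; rewrite mulr_ge0 ?powR_ge0.
have [->|/set0P Sne] := eqVneq S set0; first by rewrite inf0.
exact: lb_le_inf.
Qed.

(** The factor [t^g] that makes [energy_path_le] homogeneous is the one by which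
    the barrier of [scale t f] differs from that of [f]. *)
Lemma PWplus_scale p t f : (0 < d)%N -> 2 + 4 / d%:R < p + 1 -> 0 < t <= 1 ->
  PWplus R d p f -> PWplus R d p (scale t f).
Proof.
move=> d0 hp t01 [[Hf [f0 Ef]] Kf]; have /andP[t0 t1] := t01.
have D0 : 0 < d%:R :> R by rewrite ltr0n.
set D : R := d%:R in D0 hp.
pose s := D * (p - 1) / 4.
have s1 : 1 < s.
  rewrite /s ltr_pdivlMr// mul1r -ltr_pdivrMl//; lra.
have D4 : 0 < 4 / D by exact: divr_gt0.
have p1 : 1 < p by lra.
have D40 : 0 < D * (p - 1) - 4 by move: s1; rewrite /s ltr_pdivlMr//; lra.
have q0 : 0 < p + 1 by lra.
pose C := 2 / (p + 1) * normL (p + 1) f `^ (p + 1).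
have C0 : 0 <= C by rewrite mulr_ge0 ?powR_ge0// divr_ge0// ltW.
have n0 (r : R) : 0 <= normL r f by apply: fine_ge0; exact: Lnorm_ge0.
have enE : energy p (scale t f) = t ^+ 2 * normgrad f ^+ 2 - t `^ (p + 1) * C.
  rewrite /energy normgrad_scale// normL_scale// gtr0_norm// exprMn powRM ?(ltW t0)//.
  by rewrite /C; ring.
have viE : virial p f = normgrad f ^+ 2 - s * C.
  by rewrite /virial -/D /C mulrA; congr (_ - _ * _); rewrite /s; field; rewrite gt_eqF.
have sCA : s * C < normgrad f ^+ 2 by rewrite -subr_gt0 -viE.
pose g := (p + 1 - 2 * s) / (s - 1).
have tg0 : 0 < t `^ g by exact: powR_gt0.
have baE : t `^ g * barrier p (scale t f) = barrier p f.
  rewrite /barrier normL_scale// gtr0_norm// -/D.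
  set b := p + 1 - D / 2 * (p - 1); set k := 4 / (D * (p - 1) - 4).
  set N := infN2 d p; set m := normL 2 f.
  have N0 : 0 <= N by exact: infN2_ge0.
  have -> : N / (t * m) `^ b = (t `^ b)^-1 * (N / m `^ b).
    by rewrite [(t * m) `^ b]powRM ?(ltW t0) ?n0// invfM mulrCA.
  rewrite [(_ * (N / _)) `^ k]powRM ?invr_ge0 ?powR_ge0//; last first.
    by rewrite divr_ge0 ?powR_ge0.
  have -> : ((t `^ b)^-1) `^ k = (t `^ g)^-1.
    rewrite -!powRN -powRrM; congr (_ `^ _); rewrite /b /k /g /s; field.
    by rewrite gt_eqF.
  by rewrite mulrCA mulVKf// gt_eqF.
split; last first.
  rewrite /virial normgrad_scale// normL_scale// gtr0_norm// exprMn powRM ?(ltW t0)//.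
  rewrite -/D.
  have -> : t `^ (p + 1) = t ^+ 2 * t `^ (p - 1).
    rewrite -powR_mulrn ?(ltW t0)// -powRD ?(gt_eqF t0) ?implybT//; congr (_ `^ _).
    by ring.
  have tp : t `^ (p - 1) <= 1.
    have p10 : 0 <= p - 1 by rewrite subr_ge0 ltW.
    have := ge0_ler_powR p10 (_ : t \in Num.nneg) (_ : 1 \in Num.nneg) t1.
    by rewrite powR1; apply; rewrite nnegrE ?(ltW t0).
  rewrite (_ : _ - _ = t ^+ 2 * (normgrad f ^+ 2 - t `^ (p - 1) * (s * C))); last first.
    by rewrite /s /C; field; rewrite gt_eqF.
  rewrite mulr_gt0 ?exprn_gt0// subr_gt0; apply: le_lt_trans sCA.
  by rewrite ler_piMl// mulr_ge0// ltW// (lt_trans ltr01).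
split; first exact: H1_scale.
split; first exact: scale_neq0.
rewrite -(ltr_pM2l tg0) baE enE; apply: le_lt_trans Ef.
exact: energy_path_le.
Qed.

End potential_well.

(** * Connectedness *)

Section ray.
Context {R : realType} {d : nat}.
Implicit Types (f : cfun R d) (p q t : R).

Lemma continuous_scale q f : 0 < q -> (cLnorm q f < +oo)%E ->
  continuous (fun t : R => scale t f : cfun_Lq R d q).
Proof.
move=> q0 fq; apply/continuousP => U oU.
have f0 : (0 <= cLnorm q f)%E by exact: Lnorm_ge0.
pose N := fine (cLnorm q f).
have N0 : 0 <= N by exact: fine_ge0.
have NE : cLnorm q f = N%:E by rewrite fineK// ge0_fin_numE.
rewrite openE => t Ut; have [e e0 eU] := oU _ Ut.
apply/nbhs_ballP; exists (e / (N + 1)) => /=; first by rewrite divr_gt0// ltr_wpDl.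
move=> r tr; apply: eU; rewrite cLnorm_scaleB// NE -EFinM lte_fin.
move: tr; rewrite /ball /= distrC ltr_pdivlMr ?ltr_wpDl// => tr.
by apply: le_lt_trans tr; rewrite ler_wpM2l// lerDl.
Qed.

Lemma connected_ray q f : 0 < q -> (cLnorm q f < +oo)%E ->
  connected ((fun t => scale t f) @` `[0, 1] : set (cfun_Lq R d q)).
Proof.
move=> q0 fq; apply: connected_continuous_connected.
  by apply/connected_intervalP; exact: interval_is_interval.
by apply: continuous_subspaceT; exact: continuous_scale.
Qed.
End ray.

Theorem corollary1p5 (R : realType) (d : nat) (p : R)
    (hd : (1 <= d)%N)
    (hp : 2 + 4 / d%:R < p + 1)
    (hp' : ((p + 1)%:E < sobolev_exponent R d)%E)
    (q : R) (hq : 2 < q) (hq' : (q%:E < sobolev_exponent R d)%E) :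
  connected (PWplus R d p `|` [set cfun0] : set (cfun_Lq R d q)).
Proof.
have q0 : 0 < q by apply: lt_trans hq.
have cfun0_Lq : (cLnorm q (cfun0 : cfun R d) < +oo)%E.
  by rewrite -(scale0 cfun0) cLnorm_scale// normr0 mul0e.
set S : set (cfun_Lq R d q) := _ `|` _.
have -> : S = \bigcup_(f in S) ((fun t => scale t f) @` `[0, 1]).
  apply/seteqP; split => [f Sf|g [f Sf [t]]].
    by exists f => //; exists 1; [rewrite /= in_itv /= ler01 lexx|rewrite scale1].
  rewrite /= in_itv /= => /andP[t0 t1] <-.
  move: t0; rewrite le_eqVlt => /predU1P[<-|t0]; first by right; rewrite scale0.
  case: Sf => [Pf|->]; last by right; rewrite scale_cfun0.
  by left; apply: PWplus_scale => //; rewrite t0.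
apply: bigcup_connected.
  by exists cfun0 => f _; exists 0; [rewrite /= in_itv /= lexx ler01|rewrite scale0].
move=> f [[[Hf _] _]|->]; last exact: connected_ray.
by apply: connected_ray => //; exact: H1_Lq.
Qed.
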